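(* For $G\sim\mathcal{G}(n,7)$ the following hold: 1. With high probability, $\chi(G)\ge 4$. 2. Hoffman's bound $\chi(G)\ge 1+\lceil d/|\lambda_n(G)|\rceil$ certifies $\chi(G)\ge3$ with high probability. 3. If Conjecture L holds, then there is no polynomial-time algorithm certifying $\chi(G)\ge 4$ with high probability.
   Context: $\chi$ is the chromatic number. $\lambda_1(G)\ge\dots\ge\lambda_n(G)$ are the adjacency eigenvalues of an $n$-vertex graph $G$; for every $d$-regular $G$, $1+\lceil d/|\lambda_n(G)|\rceil$ is a lower bound on $\chi(G)$. ''With high probability'' means with probability tending to $1$ as $n\to\infty$. Models: $\mathcal{G}(n,d)$ is the uniform distribution on simple $d$-regular graphs on $[n]$; $\mathcal{G}((\frac n2,\frac n2),d)$ is the uniform distribution on simple $d$-regular bipartite graphs with both sides of size $n/2$. For a $d$-regular multigraph $H$ on $k$ vertices (loops allowed, each loop contributing $1$ to the degree; adjacency matrix $M$ with $M_{ii}$ the number of loops at $i$), the random lift $\mathcal{L}_m(H)$ is the law of the graph on $km$ vertices split into fibers of size $m$ indexed by $V(H)$. For each non-loop edge $\{i,j\}$ of $H$, an independent uniformly random perfect matching between fibers $i$ and $j$ is inserted. For each loop at $i$, an independent uniformly random perfect matching within fiber $i$ is inserted ($m$ even when loops are present). The output is conditioned on being simple. Ramanujan conditions: $H$ is Ramanujan if $\max\{|\lambda_2(H)|,|\lambda_k(H)|\}\le 2\sqrt{d-1}$. It is bipartite Ramanujan if it is bipartite and $\max\{|\lambda_2(H)|,|\lambda_{k-1}(H)|\}\le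 2\sqrt{d-1}$. Noise: for $d$-regular $G,G'$ on the same $n$ vertices, $\Delta(G,G')=|E(G)\triangle E(G')|/(2n)$. For $\epsilon\in(0,1)$ the noise models are: - $\mathcal{S}^{\mathrm{rand}}_\epsilon$ deletes $\lfloor\epsilon n\rfloor$ uniformly random edges, then adds $\lfloor\epsilon n\rfloor$ uniformly random edges conditioned on the result being $d$-regular. - $\mathcal{S}^{\mathrm{rand,bi}}_\epsilon$ is the same, except the added edges go across the bipartition. - The respectful versions $\widetilde{\mathcal{S}}^{\mathrm{rand}}_\epsilon,\widetilde{\mathcal{S}}^{\mathrm{rand,bi}}_\epsilon$, applied to $G\sim\mathcal{L}_m(H)$, additionally condition on no added edge joining the fibers of $i,j$ with $M_{ij}=0$. - Adversarial noise $\mathcal{S}^{\mathrm{adv}}_\epsilon\mathcal{L}_m(H)$ is any distribution obtained by sampling $G\sim\mathcal{L}_m(H)$ and letting an adversary (with extra randomness) output a $d$-regular $G'$ with $\Delta(G,G')\le\epsilon$. The respectful adversarial version $\widetilde{\mathcal{S}}^{\mathrm{adv}}_\epsilon$ additionally forbids adding edges between fibers of $i,j$ with $M_{ij}=0$. - ''Hard under adversarial noise'' means some choice of adversary makes it hard. An algorithm achieves strong detection between $\mathbb{P}_n$ and $\mathbb{Q}_n$ if both of its error probabilities tend to $0$. Conjecture L: for every $d$-regular Ramanujan multigraph $H$ on $k$ vertices and every $\epsilon>0$, no polynomial-time algorithm achieves strong detection between $\mathcal{S}_\epsilon\mathcal{L}_m(H)$ and $\mathcal{G}(km,d)$ as $m\to\infty$,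 for each $\mathcal{S}_\epsilon\in\{\mathcal{S}^{\mathrm{rand}}_\epsilon,\widetilde{\mathcal{S}}^{\mathrm{rand}}_\epsilon,\mathcal{S}^{\mathrm{adv}}_\epsilon,\widetilde{\mathcal{S}}^{\mathrm{adv}}_\epsilon\}$. Likewise, for every $d$-regular bipartite Ramanujan $H$ and $\epsilon>0$, none exists between $\mathcal{S}_\epsilon\mathcal{L}_m(H)$ and $\mathcal{G}((\frac{km}2,\frac{km}2),d)$, for each $\mathcal{S}_\epsilon\in\{\mathcal{S}^{\mathrm{rand,bi}}_\epsilon,\widetilde{\mathcal{S}}^{\mathrm{rand,bi}}_\epsilon,\mathcal{S}^{\mathrm{adv}}_\epsilon,\widetilde{\mathcal{S}}^{\mathrm{adv}}_\epsilon\}$. Certification: an algorithm with output $c(G)$ certifies a lower bound on $f$ if $f(G)\ge c(G)$ for every input $d$-regular $G$. It certifies $f(G)\ge B$ with high probability if moreover $\Pr[c(G)\ge B]\to1$ as $n\to\infty$. *)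

(* Defs.v *)
From HB Require Import structures.
From mathcomp Require Import all_boot all_order all_algebra all_fingroup.
From mathcomp Require Import all_classical all_reals.
From mathcomp Require Import topology normedtype sequences.

Set Implicit Arguments.
Unset Strict Implicit.
Unset Printing Implicit Defensive.

Import Order.TTheory GRing.Theory Num.Theory.
Import numFieldNormedType.Exports.

Local Open Scope ring_scope.

(* A graph is its edge set; [is_regular] imposes that edges are 2-sets. *)
Notation graph n := {set {set 'I_n}}.

Definition adj n (E : graph n) : rel 'I_n :=
  fun u v => (u != v) && ([set u; v]%SET \in E).

Definition is_regular n (d : nat) (E : graph n) : bool :=
  [forall e in E, #|e| == 2] && [forall v, #|[set e in E | v \in e]%SET| == d].

Definition regular_graphs (n d : nat) : {set graph n} :=
  [set E : graph n | is_regular d E]%SET.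

Definition balanced_bipartite n (E : graph n) : bool :=
  [exists S : {set 'I_n}, (#|S|.*2 == n) &&
    [forall u, forall v, adj E u v ==> ((u \in S) != (v \in S))]].

Definition regular_bipartite_graphs (n d : nat) : {set graph n} :=
  [set E in regular_graphs n d | balanced_bipartite E]%SET.

Definition colorable n (E : graph n) (c : nat) : bool :=
  [exists f : {ffun 'I_n -> 'I_c},
    forall u, forall v, adj E u v ==> (f u != f v)].

Lemma colorable_ex n (E : graph n) : exists c, colorable E c.
Proof.
exists n; apply/existsP; exists [ffun u => u].
by apply/forallP=> u; apply/forallP=> v; apply/implyP=> /andP[]; rewrite !ffunE.
Qed.

Definition chromatic_number n (E : graph n) : nat := ex_minn (colorable_ex E).

(* The eigenvalues with multiplicity, in nonincreasing order; the default
   value is not reached on symmetric matrices. *)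
Definition eigenvalues (R : realType) n (A : 'M[R]_n) : seq R :=
  xget [::] [set s : seq R | sorted >=%R s /\
                             char_poly A = \prod_(x <- s) ('X - x%:P)]%classic.

(* 1-based: [lambda A 1] is the largest eigenvalue. *)
Definition lambda (R : realType) n (A : 'M[R]_n) (i : nat) : R :=
  nth 0 (eigenvalues A) i.-1.

Definition adjacency (R : realType) n (E : graph n) : 'M[R]_n :=
  \matrix_(u, v) (adj E u v)%:R.

Definition hoffman_bound (R : realType) (d n : nat) (E : graph n) : int :=
  1 + Num.ceil (d%:R / `|lambda (adjacency R E) n|).

Notation law R T := {ffun T -> R} (only parsing).

Definition is_law (R : realType) (T : finType) (p : law R T) : Prop :=
  (forall x, 0 <= p x) /\ \sum_x p x = 1.

(* The conditioning of a uniform law on an event is the uniform law on it. *)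
Definition uniform (R : realType) (T : finType) (S : {set T}) : law R T :=
  [ffun x => if x \in S then (#|S|%:R)^-1 else 0].

Definition bind (R : realType) (S T : finType)
    (p : law R S) (q : S -> law R T) : law R T :=
  [ffun y => \sum_x p x * q x y].

Definition dirac (R : realType) (T : finType) (x : T) : law R T :=
  [ffun y => (y == x)%:R].

Definition prob (R : realType) (T : finType) (p : law R T) (P : pred T) : R :=
  \sum_(x | P x) p x.

(* u n --> l as n --> oo along the n satisfying D *)
Definition tends (R : realType) (D : pred nat) (u : nat -> R) (l : R) : Prop :=
  (u n @[n --> within [set n | D n] \oo] --> l)%classic.

Definition random_regular (R : realType) (n d : nat) : law R (graph n) :=
  uniform R (regular_graphs n d).

Definition random_regular_bipartite (R : realType) (n d : nat) :
    law R (graph n) :=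
  uniform R (regular_bipartite_graphs n d).

(* The sizes n for which d-regular graphs exist, up to finitely many *)
Definition regular_size (d : nat) : pred nat := fun n => ~~ odd (n * d).

Definition whp (R : realType) (d : nat) (P : forall n, pred (graph n)) : Prop :=
  tends (regular_size d) (fun n => prob (random_regular R n d) (P n)) 1.

(* Deterministic Turing machines with one two-way infinite tape over the
   alphabet {0, 1, blank}, the blank being [None]. *)
Inductive direction := MoveLeft | Stay | MoveRight.

Record machine := Machine {
  state : finType;
  start : state;
  halting : pred state;
  delta : state -> option bool -> state * option bool * direction
}.

(* In [Config q l r], [r] is the tape from the scanned cell rightwards and [l]
   the tape left of it, nearest cell first; the tape is blank beyond both. *)
Record config (T : machine) := Config {
  conf_state : state T;
  conf_left : seq (option bool);
  conf_right : seq (option bool)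
}.

Definition step (T : machine) (C : config T) : config T :=
  let: Config q l r := C in
  if halting q then C else
  let: (q', b, dir) := delta q (head None r) in
  let r' := behead r in
  match dir with
  | MoveLeft => Config q' (behead l) (head None l :: b :: r')
  | Stay => Config q' l (b :: r')
  | MoveRight => Config q' (b :: l) r'
  end.

Definition initial (T : machine) (x : seq bool) : config T :=
  Config (start T) [::] (map Some x).

Fixpoint leading_bits (r : seq (option bool)) : seq bool :=
  if r is Some b :: r' then b :: leading_bits r' else [::].

(* The output is the word that starts at the scanned cell and extends up to
   the first blank. *)
Definition outputs_within (T : machine) (x y : seq bool) (t : nat) : Prop :=
  let C := iter t (@step T) (initial T x) in
  halting (conf_state C) /\ leading_bits (conf_right C) = y.

Definition polytime (f : seq bool -> seq bool) : Prop :=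
  exists (T : machine) (c e : nat),
    forall x, outputs_within T x (f x) (c * size x ^ e + c).

(* Row-major adjacency matrix *)
Definition encode n (E : graph n) : seq bool :=
  [seq adj E u v | u <- enum 'I_n, v <- enum 'I_n].

(* Binary, most significant bit first *)
Definition decode_nat (s : seq bool) : nat :=
  foldl (fun (v : nat) (b : bool) => v.*2 + b)%N 0%N s.

Definition numeric_output (f : seq bool -> seq bool) n (E : graph n) : int :=
  (decode_nat (f (encode E)))%:Z.

(* The answer "the input comes from P" *)
Definition says_P (f : seq bool -> seq bool) n (E : graph n) : bool :=
  head false (f (encode E)).

Definition strong_detection (R : realType) (D : pred nat) (N : nat -> nat)
    (P Q : forall m, law R (graph (N m))) (f : seq bool -> seq bool) : Prop :=
  tends D (fun m => prob (P m) (fun E => ~~ says_P f E)) 0 /\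
  tends D (fun m => prob (Q m) (fun E => says_P f E)) 0.

(* A multigraph on k vertices is its adjacency matrix of multiplicities, with
   the number of loops on the diagonal. *)
Definition regular_multigraph k (d : nat) (M : 'M[nat]_k) : Prop :=
  (forall i j, M i j = M j i) /\ (forall i, (\sum_j M i j)%N = d).

Definition bipartition k (M : 'M[nat]_k) (side : 'I_k -> bool) : Prop :=
  forall i j, (0 < M i j)%N -> side i != side j.

Definition multi_adjacency (R : realType) k (M : 'M[nat]_k) : 'M[R]_k :=
  map_mx (fun a => a%:R) M.

Definition ramanujan (R : realType) k (d : nat) (M : 'M[nat]_k) : Prop :=
  let lam := lambda (multi_adjacency R M) in
  Num.max `|lam 2%N| `|lam k| <= 2 * Num.sqrt (d%:R - 1).

Definition bipartite_ramanujan (R : realType) k (d : nat) (M : 'M[nat]_k) :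
    Prop :=
  let lam := lambda (multi_adjacency R M) in
  (exists side, bipartition M side) /\
  Num.max `|lam 2%N| `|lam k.-1| <= 2 * Num.sqrt (d%:R - 1).

(* The edges of the multigraph: (i, j, a) with i <= j and a < M i j *)
Definition medge k (M : 'M[nat]_k) : finType :=
  {p : {q : 'I_k * 'I_k | (q.1 <= q.2)%N} & 'I_(M (val p).1 (val p).2)}.

Definition msrc k (M : 'M[nat]_k) (e : medge M) : 'I_k := (val (tag e)).1.
Definition mtgt k (M : 'M[nat]_k) (e : medge M) : 'I_k := (val (tag e)).2.

(* The randomness of a lift: a permutation for every edge (a matching between
   two fibers or, for a loop, within a fiber, then encoded as an involution
   without fixed points), and a labelling of the vertices by [km]. The uniform
   labelling hides the fibers from an algorithm that reads the labelled graph. *)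
Definition lift_sample k (M : 'M[nat]_k) (m : nat) : finType :=
  ({ffun medge M -> {perm 'I_m}} *
   {ffun 'I_k * 'I_m -> 'I_(k * m)})%type.

Section Lifts.
Variables (k : nat) (M : 'M[nat]_k) (m : nat).
Implicit Types w : lift_sample M m.

Definition lifted_edge w (e : medge M) : graph (k * m) :=
  [set [set w.2 (msrc e, x); w.2 (mtgt e, w.1 e x)]%SET | x : 'I_m]%SET.

Definition lift_graph w : graph (k * m) := \bigcup_e lifted_edge w e.

Definition lift_wf w : bool :=
  injectiveb w.2 &&
  [forall e, (msrc e == mtgt e) ==>
    [forall x, (w.1 e x != x) && (w.1 e (w.1 e x) == x)]].

(* A matching has no repeated edge, so the output is simple if and only if
   distinct edges lift to disjoint matchings. *)
Definition lift_simple w : bool :=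
  [forall e, forall e', (e != e') ==>
    [disjoint lifted_edge w e & lifted_edge w e']].

Definition lift_samples := [set w | lift_wf w && lift_simple w]%SET.

(* No edge of A joins the fibers of i and j unless [allowed i j]. *)
Definition respects w (allowed : rel 'I_k) (A : graph (k * m)) : bool :=
  [forall p, forall q,
    ~~ allowed p.1 q.1 ==> ([set w.2 p; w.2 q]%SET \notin A)].

End Lifts.

Definition lift_size k (M : 'M[nat]_k) : pred nat :=
  fun m => [exists i, (0 < M i i)%N] ==> ~~ odd m.

Definition noisy_lift (R : realType) k (M : 'M[nat]_k) (m : nat)
    (S : lift_sample M m -> law R (graph (k * m))) : law R (graph (k * m)) :=
  bind (uniform R (lift_samples M m)) S.

Definition noise_edges (R : realType) (eps : R) (n : nat) : nat :=
  Num.truncn (eps * n%:R).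

Definition deletions n (E : graph n) (t : nat) : {set graph n} :=
  [set D : graph n | (D \subset E) && (#|D| == t)]%SET.

(* The sets A of t new edges whose addition to E gives a d-regular graph *)
Definition additions n (d : nat) (E : graph n) (t : nat) : {set graph n} :=
  [set A : graph n |
    [&& #|A| == t, [disjoint A & E] & is_regular d (E :|: A)]]%SET.

Definition random_noise (R : realType) k (M : 'M[nat]_k) (d : nat) (eps : R)
    (allowed : rel 'I_k) (m : nat) (w : lift_sample M m) :
    law R (graph (k * m)) :=
  let E := lift_graph w in
  let t := noise_edges eps (k * m) in
  bind (uniform R (deletions E t)) (fun D : graph (k * m) =>
  bind (uniform R [set A in additions d (E :\: D) t | respects w allowed A]%SET)
    (fun A : graph (k * m) => dirac R ((E :\: D) :|: A))).

Definition edge_distance (R : realType) n (E E' : graph n) : R :=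
  #|(E :\: E') :|: (E' :\: E)|%:R / (2 * n%:R).

(* An adversary is a Markov kernel from lifts to graphs, so that it has
   unlimited computing power and randomness and sees the fibers. *)
Definition adversary (R : realType) k (M : 'M[nat]_k) :=
  forall m : nat, lift_sample M m -> law R (graph (k * m)).

Definition valid_adversary (R : realType) k (M : 'M[nat]_k) (d : nat) (eps : R)
    (allowed : rel 'I_k) (S : adversary R M) : Prop :=
  forall m (w : lift_sample M m), w \in lift_samples M m ->
    is_law (S m w) /\
    forall E' : graph (k * m), S m w E' != 0 ->
      [/\ is_regular d E',
          edge_distance R (lift_graph w) E' <= eps &
          respects w allowed (E' :\: lift_graph w)].

Definition anywhere k : rel 'I_k := fun _ _ => true.
Definition on_edges k (M : 'M[nat]_k) : rel 'I_k := fun i j => M i j != 0%N.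
Definition across k (side : 'I_k -> bool) : rel 'I_k :=
  fun i j => side i != side j.

Definition hard (R : realType) k (M : 'M[nat]_k)
    (P Q : forall m, law R (graph (k * m))) : Prop :=
  ~ exists f, polytime f /\
              strong_detection (N := muln k) (lift_size M) P Q f.

Definition hard_random (R : realType) k (M : 'M[nat]_k) (d : nat) (eps : R)
    (allowed : rel 'I_k) (Q : forall m, law R (graph (k * m))) : Prop :=
  hard M (fun m => noisy_lift (@random_noise R k M d eps allowed m)) Q.

Definition hard_adversarial (R : realType) k (M : 'M[nat]_k) (d : nat) (eps : R)
    (allowed : rel 'I_k) (Q : forall m, law R (graph (k * m))) : Prop :=
  exists S : adversary R M, valid_adversary d eps allowed S /\
    hard M (fun m => noisy_lift (S m)) Q.

(* 3 <= d makes 2 sqrt (d - 1) < d. For d = 2 every base graph would qualify,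
   even a disconnected one, whose respectfully noised lifts are told apart from
   random 2-regular graphs by counting cycles. *)
Definition ConjectureL (R : realType) : Prop :=
  forall (d k : nat) (M : 'M[nat]_k) (eps : R),
    (3 <= d)%N -> (0 < k)%N -> regular_multigraph d M -> 0 < eps < 1 ->
  (ramanujan R d M ->
    let Q := fun m => random_regular R (k * m) d in
    [/\ hard_random M d eps (@anywhere k) Q,
        hard_random M d eps (on_edges M) Q,
        hard_adversarial M d eps (@anywhere k) Q &
        hard_adversarial M d eps (on_edges M) Q]) /\
  (bipartite_ramanujan R d M ->
    forall side : 'I_k -> bool, bipartition M side ->
    let Q := fun m => random_regular_bipartite R (k * m) d in
    [/\ hard_random M d eps (across side) Q,
        hard_random M d eps (fun i j => across side i j && on_edges M i j) Q,
        hard_adversarial M d eps (@anywhere k) Q &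
        hard_adversarial M d eps (on_edges M) Q]).

Definition certifies (d : nat) (F : forall n, graph n -> nat)
    (c : forall n, graph n -> int) : Prop :=
  forall n (E : graph n), (0 < n)%N -> is_regular d E -> c n E <= (F n E)%:Z.

Definition certifies_whp (R : realType) (d : nat) (F : forall n, graph n -> nat)
    (c : forall n, graph n -> int) (B : nat) : Prop :=
  certifies d F c /\ whp R d (fun n E => B%:Z <= c n E).

(* Main.v *)
(* Balanced words, in which every vertex occurs 7 times, are the configuration
   model of random 7-regular graphs: the simple words are equidistributed over
   the graphs, and switchings show that a positive fraction of the balanced
   words is simple. So it is enough to bound probabilities for balanced words.
   Permuting the positions of a word reduces these to weighted counts of
   colour patterns, hence to Stirling's formula: a fixed 3-colouring is proper
   with probability at most poly(n) (2/3)^(7n/2), and 3 (2/3)^(7/2) < 1; a pair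
   of vertex sets of size s spans a bipartite component with probability at
   most poly(n) (s/n)^(7s). Hoffman's bound is below 3 only if -7 is an
   eigenvalue, that is, if there is a bipartite component.
   For the hardness part, a certificate of chi >= 4 would tell random 7-regular
   graphs from the respectfully noised lifts of a 7-regular Ramanujan multigraph
   on 6 vertices which is 3-colourable, because these lifts inherit its
   3-colouring. *)
From mathcomp Require Import all_classical all_reals.
From mathcomp Require Import topology normedtype sequences exp.
From mathcomp Require Import all_boot all_order all_algebra all_fingroup.
From mathcomp Require Import ring lra zify complex.
Require Import Defs.

Set Implicit Arguments.
Unset Strict Implicit.
Unset Printing Implicit Defensive.

Import Order.TTheory GRing.Theory Num.Theory.
Import numFieldNormedType.Exports.

Local Open Scope ring_scope.

(** * Balanced words and regular graphs *)

(** The two counting bounds have different slack. Colourings lose to a geometric factor, so any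
    polynomial loss is harmless. For bipartite components the critical case is [s = 1], where about
    [n ^ 2] choices meet the factor [n ^ (-7)]: of the resulting [n ^ (-5)], three powers pay for
    the Stirling errors of three colour classes and one for the sum over [s]. The weights of the
    pattern count are free parameters: the number of patterns with prescribed class sizes is bounded
    by a generating function evaluated at a point, and a good point makes the entropy factors
    cancel. The base graph has to fit a window. By Hoffman's inequality a 3-colourable 7-regular
    graph has least eigenvalue at most [-7/2], while the Ramanujan condition allows nothing below
    [-2 sqrt 6], about [-4.9]. A block-circulant matrix over the 3-cycle splits into [2 x 2] blocks
    under the Fourier transform; the chosen blocks give [7], [1] and, twice each, [-2 + sqrt 3] and
    [-2 - sqrt 3], hence a least eigenvalue of about [-3.73]. *)

Section Words.
Variables (Q : finType) (n : nat).
Implicit Types (p r : Q * bool) (w : {ffun Q * bool -> 'I_n}) (d : nat).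

(** [Q] indexes edges, so [Q * bool] is the set of half-edges and [flip] leads to the other end of
    the same edge. *)
Definition flip p : Q * bool := (p.1, ~~ p.2).

Lemma flipK : involutive flip.
Proof. by case=> q b; rewrite /flip /= negbK. Qed.

Lemma flip_inj : injective flip. Proof. exact: inv_inj flipK. Qed.

Lemma flip_neq p : flip p != p.
Proof. by case: p => q [] /=; rewrite /flip /= xpair_eqE andbF. Qed.

Definition occ w (v : 'I_n) : {set Q * bool} := [set p | w p == v]%SET.

Definition balanced d : {set {ffun Q * bool -> 'I_n}} :=
  [set w | [forall v, #|occ w v| == d]]%SET.

Lemma balancedP d w : reflect (forall v, #|occ w v| = d) (w \in balanced d).
Proof.
by rewrite inE; apply: (iffP forallP) => H v; [apply/eqP | rewrite H].
Qed.

Definition dart w p : 'I_n * 'I_n := (w p, w (flip p)).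

(* A loop at [p] gives [p] and [flip p] the same dart, and two parallel edges
   share their darts, so this says that the multigraph of [w] is simple. *)
Definition simple w : bool := injectiveb (dart w).

Definition pair_edge w (q : Q) : {set 'I_n} :=
  [set w (q, false); w (q, true)]%SET.

Definition word_graph w : graph n := [set pair_edge w q | q : Q]%SET.

Lemma pair_edgeE w p : pair_edge w p.1 = [set w p; w (flip p)]%SET.
Proof. by case: p => q [] //=; rewrite /pair_edge setUC. Qed.

Lemma simple_loopless w p : simple w -> w p != w (flip p).
Proof.
move/injectiveP=> sw; apply/eqP=> e.
by have /sw/eqP : dart w (flip p) = dart w p; rewrite ?(negPf (flip_neq p)) // /dart flipK e.
Qed.

Lemma set2_eqP (T : finType) (a b c e : T) :
  [set a; b]%SET = [set c; e]%SET -> (a = c /\ b = e) \/ (a = e /\ b = c).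
Proof.
move=> E.
have ha : a \in [set c; e]%SET by rewrite -E !inE eqxx.
have hb : b \in [set c; e]%SET by rewrite -E !inE eqxx orbT.
have hc : c \in [set a; b]%SET by rewrite E !inE eqxx.
have he : e \in [set a; b]%SET by rewrite E !inE eqxx orbT.
move: ha hb hc he; rewrite !inE => /orP[]/eqP-> /orP[]/eqP-> ; auto.
  by move=> _; rewrite orbb => /eqP; auto.
by rewrite orbb => /eqP->; auto.
Qed.

Lemma simpleP w : reflect
  ((forall p, w p != w (flip p)) /\ injective (pair_edge w)) (simple w).
Proof.
apply: (iffP idP) => [sw|[nl inj]].
  split=> [p|q q' E]; first exact: simple_loopless.
  move/injectiveP: sw => sw; move: E.
  rewrite (pair_edgeE w (q, false)) (pair_edgeE w (q', false)).
  move=> /set2_eqP[[e1 e2]|[e1 e2]].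
    by have /sw[] : dart w (q, false) = dart w (q', false) by rewrite /dart e1 e2.
  have /sw[//] : dart w (q, false) = dart w (q', true).
  by rewrite /dart e1 e2.
apply/injectiveP=> p p' [e1 e2].
have E : pair_edge w p.1 = pair_edge w p'.1 by rewrite !pair_edgeE e1 e2.
move/inj: E; case: p p' e1 e2 => q b [q' b'] /= e1 e2 E; subst q'.
congr pair; case: b b' e1 e2 => [] [] //= e1 e2.
  by have := nl (q, true); rewrite e1 eqxx.
by have := nl (q, false); rewrite e1 eqxx.
Qed.

Lemma simple_card_edge w q : simple w -> #|pair_edge w q| = 2%N.
Proof. by move=> /simple_loopless sw; rewrite cards2 (sw (q, false)). Qed.

Lemma card_incident w v : simple w ->
  #|[set e in word_graph w | v \in e]%SET| = #|occ w v|.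
Proof.
move=> sw; have [nl inj] := simpleP _ sw.
have -> : [set e in word_graph w | v \in e]%SET =
          [set pair_edge w p.1 | p in occ w v]%SET.
  apply/setP=> e; rewrite inE; apply/andP/imsetP => [[]|[p]].
    move=> /imsetP[q _ ->]; rewrite !inE => /orP[] /eqP->.
      by exists (q, false); rewrite ?inE.
    by exists (q, true); rewrite ?inE.
  rewrite inE => /eqP <- ->; split; first exact: imset_f.
  by rewrite pair_edgeE !inE eqxx.
rewrite card_in_imset // => p p'; rewrite !inE => /eqP e1 /eqP e2 /inj.
case: p p' e1 e2 => q b [q' b'] /= e1 e2 E; subst q'.
congr pair; case: b b' e1 e2 => [] [] //= e1 e2.
  by have := nl (q, true); rewrite e1 /flip /= e2 eqxx.
by have := nl (q, false); rewrite e1 /flip /= e2 eqxx.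
Qed.

Lemma simple_balanced_regular d w : simple w ->
  is_regular d (word_graph w) = (w \in balanced d).
Proof.
move=> sw; rewrite /is_regular inE.
have -> : [forall e in word_graph w, #|e| == 2].
  apply/forall_inP=> e /imsetP[q _ ->]; exact/eqP/simple_card_edge.
by apply: eq_forallb => v; rewrite card_incident.
Qed.

Lemma regular_card d (E : graph n) : is_regular d E -> (#|E| * 2 = n * d)%N.
Proof.
move=> /andP[/forall_inP E2 /forallP Ed].
transitivity (\sum_(e in E) \sum_(v in e) 1)%N.
  rewrite -sum_nat_const; apply: eq_bigr => e /E2/eqP e2.
  by rewrite sum1_card e2.
rewrite (exchange_big_dep predT) //= -[n in RHS]card_ord -sum_nat_const.
apply: eq_bigr => v _; rewrite -(eqP (Ed v)) -sum1_card.
by apply: eq_bigl => e; rewrite inE.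
Qed.

Lemma big_pair_words (S : comPzSemiRingType) (T : finType)
    (F : Q -> T -> T -> S) :
  \sum_(w : {ffun Q * bool -> T}) \prod_q F q (w (q, false)) (w (q, true)) =
  \prod_q \sum_(a : T) \sum_(b : T) F q a b.
Proof.
under [RHS]eq_bigr => q _ do rewrite pair_big /=.
rewrite (bigA_distr_bigA (fun q (j : T * T) => F q j.1 j.2)).
pose g (f : {ffun Q -> T * T}) : {ffun Q * bool -> T} :=
  [ffun p => if p.2 then (f p.1).2 else (f p.1).1].
pose g' (w : {ffun Q * bool -> T}) : {ffun Q -> T * T} :=
  [ffun q => (w (q, false), w (q, true))].
rewrite (reindex g); last first.
  exists g' => [f _|w _]; apply/ffunP.
    by move=> q; rewrite !ffunE /=; case: (f q).
  by case=> q []; rewrite !ffunE.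
by apply: eq_bigr => f _; apply: eq_bigr => q _; rewrite !ffunE.
Qed.

Lemma card_words_of_edges (f : Q -> {set 'I_n}) :
  (forall q, #|f q| = 2%N) ->
  #|[set w | [forall q, pair_edge w q == f q]]%SET| = (2 ^ #|Q|)%N.
Proof.
move=> f2; rewrite -sum1_card big_mkcond /=.
transitivity (\sum_(w : {ffun Q * bool -> 'I_n}) \prod_q
    (fun (q : Q) (a b : 'I_n) => (([set a; b]%SET == f q) : nat)) q
      (w (q, false)) (w (q, true)))%N.
  apply: eq_bigr => w _; rewrite inE.
  case: ifP => [/forallP H|/negbT].
    by rewrite big1 // => q _; have := H q; rewrite /pair_edge => ->.
  rewrite negb_forall => /existsP[q /negPf H].
  by rewrite (bigD1 q) //=; move: H; rewrite /pair_edge => ->.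
rewrite (@big_pair_words nat 'I_n
  (fun (q : Q) (a b : 'I_n) => (([set a; b]%SET == f q) : nat))).
transitivity (\prod_(q : Q) 2)%N; last by rewrite prod_nat_const.
apply: eq_bigr => q _.
have [x [y [nxy ->]]] : exists x y, x != y /\ f q = [set x; y]%SET.
  by apply/cards2P; rewrite f2.
transitivity (\sum_(ab : 'I_n * 'I_n) (ab \in [set (x, y); (y, x)]%SET))%N.
  rewrite pair_big /=; apply: eq_bigr => [[a b] _] /=; congr nat_of_bool.
  rewrite !inE /= !xpair_eqE; apply/eqP/orP => [/set2_eqP[[-> ->]|[-> ->]]|].
  - by left; rewrite !eqxx.
  - by right; rewrite !eqxx.
  by case=> /andP[/eqP-> /eqP->] //; rewrite setUC.
rewrite -big_mkcond /= sum1_card cards2 xpair_eqE (negPf nxy) //.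
Qed.

(* An enumeration of the edges and an orientation of each of them. *)
Lemma card_words_of_graph d (E : graph n) :
  (#|Q| * 2 = n * d)%N -> is_regular d E ->
  #|[set w | simple w && (word_graph w == E)]%SET| = ((#|Q|)`! * 2 ^ #|Q|)%N.
Proof.
move=> cQ rE; have cE : #|E| = #|Q|.
  by apply/eqP; rewrite -(eqn_pmul2r (isT : 0 < 2)%N) cQ (regular_card rE).
have E2 e : e \in E -> #|e| = 2%N.
  by case/andP: rE => /forall_inP H _ /H/eqP.
pose A := [set f : {ffun Q -> {set 'I_n}} | (f \in ffun_on (mem E)) && injectiveb f]%SET.
have cA : #|A| = (#|Q|)`! by rewrite card_inj_ffuns_on cE ffactnn.
pose h w : {ffun Q -> {set 'I_n}} := [ffun q => pair_edge w q].
rewrite -sum1_card (partition_big h (mem A)) /=; last first.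
  move=> w; rewrite inE => /andP[/simpleP[_ inj] /eqP wE]; rewrite inE.
  apply/andP; split.
    by apply/ffun_onP=> q; rewrite ffunE -wE imset_f.
  by apply/injectiveP=> q q'; rewrite !ffunE => /inj.
rewrite -cA -sum_nat_const; apply: eq_bigr => f; rewrite inE => /andP[/ffun_onP fE /injectiveP fi].
rewrite -(@card_words_of_edges f) => [|q]; last exact: E2.
rewrite -sum1_card; apply: eq_bigl => w; rewrite !inE.
have -> : (h w == f) = [forall q, pair_edge w q == f q].
  apply/eqP/forallP => [<- q|H]; first by rewrite ffunE.
  by apply/ffunP=> q; rewrite ffunE; apply/eqP.
case: forallP => [H|]; rewrite ?andbF // andbT.
have He q : pair_edge w q = f q by apply/eqP.
apply/andP; split; last first.
  rewrite eqEcard; apply/andP; split.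
    by apply/subsetP=> e /imsetP[q _ ->]; rewrite He fE.
  by rewrite cE card_imset // => q q'; rewrite !He => /fi.
apply/simpleP; split=> [p|q q']; last by rewrite !He => /fi.
have := E2 _ (fE p.1); rewrite -He pair_edgeE cards2.
by case: eqP.
Qed.

End Words.

(** * Switchings *)

Lemma sum_boolE (T : finType) (A : {set T}) (F : pred T) :
  (\sum_(x in A) F x = #|[set x in A | F x]%SET|)%N.
Proof.
rewrite -sum1_card big_mkcond [RHS]big_mkcond /=.
by apply: eq_bigr => x _; rewrite inE; case: (x \in A) => //=; case: (F x).
Qed.

Lemma sum_bool_cardT (T : finType) (F : pred T) :
  (\sum_(x : T) F x = #|[set x | F x]%SET|)%N.
Proof.
rewrite -sum1_card [RHS]big_mkcond /=.
by apply: eq_bigr => x _; rewrite inE; case: (F x).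
Qed.

Section Switching.
Variables (Q : finType) (n d : nat).
Implicit Types (p r : Q * bool) (w : {ffun Q * bool -> 'I_n}).
Local Notation B := (balanced Q n d).
Local Notation N := #|{: Q * bool}|.

Definition swap w p r : {ffun Q * bool -> 'I_n} := [ffun x => w (tperm p r x)].

Lemma swapK p r : involutive (fun w => swap w p r).
Proof. by move=> w; apply/ffunP=> x; rewrite !ffunE tpermK. Qed.

Lemma swapC w p r : swap w p r = swap w r p.
Proof. by apply/ffunP=> x; rewrite !ffunE tpermC. Qed.

Lemma swap_balanced w p r : (swap w p r \in B) = (w \in B).
Proof.
rewrite !inE; apply: eq_forallb => v; congr (_ == _).
rewrite -[RHS](card_imset _ (@perm_inj _ (tperm p r))); apply: eq_card => x.
apply/idP/imsetP => [|[y]]; rewrite ?inE ?ffunE.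
  by move=> h; exists (tperm p r x); rewrite ?inE ?tpermK.
by move=> h ->; rewrite ?inE ?ffunE tpermK.
Qed.

Lemma sum_swap p r (F : pred {ffun Q * bool -> 'I_n}) :
  (\sum_(w in B) F (swap w p r) = \sum_(w in B) F w)%N.
Proof.
rewrite [RHS](reindex_inj (inv_inj (swapK p r))) /=.
by apply: eq_bigl => w; rewrite swap_balanced.
Qed.

Definition bad w p : bool := [exists p', (p' != p) && (dart w p' == dart w p)].
Definition bads w : {set Q * bool} := [set p | bad w p]%SET.
Definition loop w p : bool := w p == w (flip p).

(** The closed neighbourhood of [u]: the values that, put opposite to [u], would create a loop or a
    parallel edge. *)
Definition nbhd w (u : 'I_n) : {set 'I_n} :=
  (u |: [set w (flip x) | x in occ w u])%SET.

Lemma nbhdP w u v : reflect (v = u \/ exists2 x, w x = u & w (flip x) = v)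
  (v \in nbhd w u).
Proof.
rewrite !inE; apply: (iffP orP) => [[/eqP->|/imsetP[x]]|[->|[x h <-]]].
- by left.
- by rewrite inE => /eqP h ->; right; exists x.
- by left.
by right; apply: imset_f; rewrite inE h.
Qed.

Lemma nbhd_sym w u v : (v \in nbhd w u) = (u \in nbhd w v).
Proof.
apply/nbhdP/nbhdP => [] [->|[x h1 h2]]; try by left.
  by right; exists (flip x) => //; rewrite flipK.
by right; exists (flip x) => //; rewrite flipK.
Qed.

Lemma nbhd_flip w p : w p \in nbhd w (w (flip p)).
Proof. by apply/nbhdP; right; exists (flip p) => //; rewrite flipK. Qed.

Lemma badP w p :
  reflect (exists p', [/\ p' != p, w p' = w p & w (flip p') = w (flip p)])
          (bad w p).
Proof.
apply: (iffP existsP) => [[p' /andP[h /eqP[h1 h2]]]|[p' [h h1 h2]]].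
  by exists p'.
by exists p'; rewrite h /dart h1 h2 eqxx.
Qed.

Lemma bad_flip w p : bad w (flip p) = bad w p.
Proof.
have H p1 : bad w p1 -> bad w (flip p1).
  move=> /badP[p' [h h1 h2]]; apply/badP; exists (flip p').
  by rewrite (inj_eq (@flip_inj Q)) !flipK.
by apply/idP/idP => [/H|/H //]; rewrite flipK.
Qed.

Lemma loop_bad w p : loop w p -> bad w p.
Proof.
by move=> /eqP h; apply/badP; exists (flip p); rewrite flip_neq flipK h.
Qed.

Lemma bads0 w : (bads w == set0) = simple w.
Proof.
apply/eqP/injectiveP => [b0 p p' e|inj].
  apply/eqP/negPn/negP => np; have : p' \in bads w.
    by rewrite inE; apply/existsP; exists p; rewrite np e eqxx.
  by rewrite b0 inE.
apply/setP=> p; rewrite !inE; apply/negbTE/negP => /badP[p' [/eqP h h1 h2]].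
by apply: h; apply: inj; rewrite /dart h1 h2.
Qed.

Lemma swapL w p r : swap w p r p = w r. Proof. by rewrite ffunE tpermL. Qed.

Lemma swapD w p r x : x != p -> x != r -> swap w p r x = w x.
Proof. by move=> h1 h2; rewrite ffunE tpermD // eq_sym. Qed.

(** Besides a new value in the neighbourhood of the opposite end, there is one more way to a bad
    [p]: exchanging ends between two loops turns them into a double edge. *)
Lemma bad_swap w p r : bad (swap w p r) p ->
  (w r \in nbhd w (w (flip p))) || (loop w p && loop w r).
Proof.
move=> /badP[p' [np h1 h2]]; apply/orP.
have [|C1] := boolP (w r \in _); [by left | right].
have rp : r != p by apply: contraNneq C1 => ->; apply: nbhd_flip.
have rfp : r != flip p.
  by apply: contraNneq C1 => ->; apply/nbhdP; left.
rewrite swapL in h1; rewrite (@swapD _ _ _ (flip p)) ?flip_neq // 1?eq_sym // in h2.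
have [e|npr] := eqVneq p' r.
  move: h1; rewrite e swapC swapL => h1; case/negP: C1; rewrite -h1.
  exact: nbhd_flip.
rewrite (swapD w np npr) in h1.
have [e|nfr] := eqVneq (flip p') r.
  rewrite e swapC swapL in h2.
  have fr : flip r = p' by rewrite -e flipK.
  by rewrite /loop fr h1 h2 !eqxx.
have [e|nfp] := eqVneq (flip p') p.
  by case/negP: C1; apply/nbhdP; left; rewrite -h1 -e flipK.
rewrite (swapD w nfp nfr) in h2.
by case/negP: C1; apply/nbhdP; right; exists (flip p'); rewrite ?flipK.
Qed.

(** The side conditions make [p] and [r] good after the swap, and badness is shared by flips, so the
    bad positions of the new word and their partners have kept their darts: they were bad before,
    and [p] has left the set. *)
Lemma bads_swap w p r : bad w p -> ~~ bad w r ->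
  w r \notin nbhd w (w (flip p)) -> w (flip r) \notin nbhd w (w p) ->
  (#|bads (swap w p r)| < #|bads w|)%N.
Proof.
move=> bp br C1 C2.
have nlr : ~~ loop w r by apply: contra br; apply: loop_bad.
have np : ~~ bad (swap w p r) p.
  by apply/negP => /bad_swap; rewrite (negPf C1) (negPf nlr) andbF.
have nr : ~~ bad (swap w p r) r.
  by rewrite swapC; apply/negP => /bad_swap; rewrite nbhd_sym (negPf C2) (negPf nlr).
apply: proper_card; apply/properP; split; last by exists p; rewrite !inE.
apply/subsetP=> x; rewrite !inE => bx.
have D y : bad (swap w p r) y -> swap w p r y = w y.
  by move=> b; rewrite swapD //; apply: contraTneq b => ->.
have Df y : bad (swap w p r) y -> swap w p r (flip y) = w (flip y).
  by rewrite -bad_flip => /D.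
have /badP[x' [nx h1 h2]] := bx.
have bx' : bad (swap w p r) x' by apply/badP; exists x; rewrite eq_sym.
by apply/badP; exists x'; rewrite -(D _ bx) -(D _ bx') -(Df _ bx) -(Df _ bx').
Qed.

Lemma card_occ_nbhd w u : w \in B ->
  (#|[set r | w r \in nbhd w u]%SET| <= d * d.+1)%N.
Proof.
move=> /balancedP bw; rewrite -sum1_card (partition_big w (mem (nbhd w u))) /=; last first.
  by move=> r; rewrite inE.
apply: (@leq_trans (\sum_(v in nbhd w u) d)).
  apply: leq_sum => v _; rewrite -(bw v) -sum1_card [X in (_ <= X)%N]big_mkcond.
  rewrite [X in (X <= _)%N]big_mkcond; apply: leq_sum => r _.
  by rewrite !inE; case: (w r == v); rewrite ?andbF // andbT; case: ifP.
rewrite sum_nat_const mulnC leq_mul2l; apply/orP; right.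
rewrite cardsU1 -add1n; apply: leq_add; first by case: (_ \notin _).
by rewrite -(bw u) leq_imset_card.
Qed.

Lemma card_occ_nbhd_flip w u : w \in B ->
  (#|[set r | w (flip r) \in nbhd w u]%SET| <= d * d.+1)%N.
Proof.
move=> bw; rewrite -(card_imset _ (@flip_inj Q)).
apply: leq_trans (card_occ_nbhd u bw); apply: subset_leq_card.
by apply/subsetP=> _ /imsetP[r + ->]; rewrite !inE.
Qed.

(** Each swap is an involution of the balanced words, so swapping [p] with a random position
    preserves the uniform law. Bounds for a fixed [w] and random [r] thus become bounds on averages
    over [w]. *)
Lemma mean_swap p (F : pred {ffun Q * bool -> 'I_n}) :
  (N * \sum_(w in B) F w = \sum_(w in B) \sum_r F (swap w p r))%N.
Proof.
rewrite exchange_big /= -sum_nat_const; apply: eq_bigr => r _.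
by rewrite sum_swap.
Qed.

Lemma mean_loop p : (N * \sum_(w in B) loop w p <= #|B| * d)%N.
Proof.
rewrite (mean_swap p (fun w => loop w p)) -sum_nat_const; apply: leq_sum => w.
move=> /balancedP bw; rewrite sum_bool_cardT -(bw (w (flip p))).
apply: subset_leq_card; apply/subsetP=> r; rewrite !inE /loop swapL.
have [->//|fr] := eqVneq (flip p) r.
by rewrite swapD ?flip_neq.
Qed.

(** At most [d * d.+1] positions [r] carry a value near the opposite end, and the case of two loops
    costs [d] more by [mean_loop]. *)
Lemma mean_bad p : (N * \sum_(w in B) bad w p <= #|B| * (d * d.+2))%N.
Proof.
rewrite (mean_swap p (fun w => bad w p)).
apply: (@leq_trans (\sum_(w in B) (d * d.+1 + N * loop w p))).
  apply: leq_sum => w wB.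
  apply: (@leq_trans (\sum_r ((w r \in nbhd w (w (flip p))) + loop w p))).
    apply: leq_sum => r _; case H : (bad _ _) => //.
    by have := bad_swap H; case: (_ \in _) => //= /andP[-> _].
  rewrite big_split /= sum_nat_const leq_add2r sum_bool_cardT.
  exact: card_occ_nbhd.
rewrite big_split /= sum_nat_const -big_distrr /=.
by rewrite [(d * d.+2)%N]mulnS mulnDr [X in (_ <= X)%N]addnC leq_add2l mean_loop.
Qed.

Lemma mean_bads : (0 < N)%N -> (\sum_(w in B) #|bads w| <= #|B| * (d * d.+2))%N.
Proof.
move=> N0; rewrite -(leq_pmul2l N0).
have -> : (\sum_(w in B) #|bads w| = \sum_p \sum_(w in B) bad w p)%N.
  rewrite exchange_big /=; apply: eq_bigr => w _.
  by rewrite sum_bool_cardT.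
rewrite big_distrr /= -sum_nat_const; apply: leq_sum => p _; exact: mean_bad.
Qed.

Definition few k := [set w in B | (#|bads w| <= k)%N]%SET.

Lemma fewE k w : (w \in few k) = (w \in B) && (#|bads w| <= k)%N.
Proof. by rewrite inE. Qed.

Lemma markov_bads : (0 < N)%N -> (0 < d)%N ->
  (#|B| <= 2 * #|few (2 * (d * d.+2))|)%N.
Proof.
move=> N0 d0; set C := (d * d.+2)%N.
have C0 : (0 < C)%N by rewrite muln_gt0 d0.
pose many := [set w in B | (2 * C < #|bads w|)%N]%SET.
have mE w : (w \in many) = (w \in B) && (2 * C < #|bads w|)%N by rewrite inE.
have H : (2 * C * #|many| <= #|B| * C)%N.
  apply: leq_trans (mean_bads N0); rewrite mulnC -sum_nat_const.
  rewrite [X in (_ <= X)%N](bigID (mem many)) /=.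
  apply: leq_trans (leq_addr _ _).
  rewrite [X in (_ <= X)%N](eq_bigl (mem many)); last first.
    by move=> w; rewrite /= mE andbA andbb.
  by apply: leq_sum => w; rewrite mE => /andP[_ /ltnW].
have E : (#|B| = #|few (2 * C)| + #|many|)%N.
  rewrite -(cardsID (few (2 * C)) B); congr (_ + _)%N.
    by apply: eq_card => w; rewrite in_setI fewE andbA andbb.
  apply: eq_card => w; rewrite in_setD mE fewE.
  by case: (w \in B); case: leqP; rewrite ?andbF.
nia.
Qed.

(* Double counting of the pairs [(w, swap w p r)] with [w] in [few k.+1] but
   not in [few k], [p] bad in [w], and [swap w p r] in [few k]. *)
Lemma few_step k K : (k < K)%N -> (4 * (d * d.+1) + 2 * K <= N)%N ->
  (#|few k.+1| <= (1 + 2 * (d * d.+1 + K)) * #|few k|)%N.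
Proof.
move=> kK; set C := (d * d.+1)%N => NK.
pose S := [set w in B | #|bads w| == k.+1]%SET.
have SE w : (w \in S) = (w \in B) && (#|bads w| == k.+1) by rewrite inE.
have E : (#|few k.+1| = #|few k| + #|S|)%N.
  rewrite -(cardsID (few k) (few k.+1)); congr (_ + _)%N; apply: eq_card => w.
    by rewrite in_setI !fewE; case: (w \in B) => //=; lia.
  by rewrite in_setD SE !fewE; case: (w \in B) => //=; rewrite ?andbF //; lia.
suff H : (#|S| * N <= 2 * (#|few k| * (N * (C + K))))%N.
  have N0 : (0 < N)%N by lia.
  have : (#|S| <= 2 * (#|few k| * (C + K)))%N by rewrite -(leq_pmul2r N0); nia.
  by rewrite E; nia.
have H1 : (#|S| * N <= 2 * \sum_(w in S) \sum_p \sum_r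
    (bad w p && (swap w p r \in few k)))%N.
  rewrite -sum_nat_const big_distrr /=; apply: leq_sum => w; rewrite SE => /andP[wB /eqP bw].
  have /card_gt0P[p pb] : (0 < #|bads w|)%N by rewrite bw.
  rewrite inE in pb.
  rewrite (bigD1 p) //= mulnDr; apply: leq_trans (leq_addr _ _).
  (* The positions [r] to which [bads_swap] does not apply. They are at most half of all positions,
     which accounts for the factor 2. *)
  pose X := ([set r | w r \in nbhd w (w (flip p))] :|:
     [set r | w (flip r) \in nbhd w (w p)] :|: bads w)%SET.
  have cX : (#|X| <= C + C + K)%N.
    apply: leq_trans (leq_card_setU _ _) _; apply: leq_add; last by rewrite bw.
    apply: leq_trans (leq_card_setU _ _) _.
    by apply: leq_add; [apply: card_occ_nbhd | apply: card_occ_nbhd_flip].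
  have cC : (#|~: X| <= \sum_r (bad w p && (swap w p r \in few k)))%N.
    rewrite sum_bool_cardT; apply: subset_leq_card; apply/subsetP=> r.
    rewrite in_setC !in_setU !negb_or => /andP[/andP[c1 c2] c3].
    rewrite in_set in c1; rewrite in_set in c2; rewrite in_set in c3.
    rewrite in_set fewE swap_balanced wB pb /= -ltnS -bw; exact: bads_swap.
  have cXC : (#|X| + #|(~: X)%SET| = N)%N by rewrite cardsC.
  have cXN := leq_trans (leq_add cX cC); rewrite cXC in cXN.
  have {cXN} := cXN _ (leqnn _); set z := (\sum_r _)%N => cXN.
  rewrite -/z; clear -NK cXN; lia.
apply: (leq_trans H1); rewrite leq_mul2l; apply/orP; right.
have -> : (\sum_(w in S) \sum_p \sum_r (bad w p && (swap w p r \in few k)) =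
  \sum_p \sum_r \sum_(w in S) (bad w p && (swap w p r \in few k)))%N.
  by rewrite exchange_big; apply: eq_bigr => p _; rewrite exchange_big.
apply: (@leq_trans (\sum_p \sum_r \sum_(w in few k) bad (swap w p r) p)).
  apply: leq_sum => p _; apply: leq_sum => r _.
  rewrite !sum_boolE -(card_imset _ (inv_inj (swapK p r))).
  apply: subset_leq_card; apply/subsetP=> _ /imsetP[w + ->].
  rewrite in_set => /andP[_ /andP[b wk]].
  by rewrite in_set wk /= swapK b.
have -> : (\sum_p \sum_r \sum_(w in few k) bad (swap w p r) p =
  \sum_(w in few k) \sum_p \sum_r bad (swap w p r) p)%N.
  rewrite [RHS]exchange_big; apply: eq_bigr => p _.
  by rewrite [RHS]exchange_big.
rewrite -sum_nat_const; apply: leq_sum => w; rewrite fewE => /andP[wB wk].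
rewrite -sum_nat_const; apply: leq_sum => p _.
(* Reverse count: [p] is bad after the swap only if the value at [r] is near the opposite end, or if
   [r] is a loop, hence one of the few bad positions. *)
apply: (@leq_trans (\sum_r ((w r \in nbhd w (w (flip p))) + bad w r))).
  apply: leq_sum => r _; case H : (bad _ _) => //.
  have := bad_swap H; case: (_ \in _) => //= /andP[_ /loop_bad].
  by case: (bad w r).
rewrite big_split /= !sum_bool_cardT; apply: leq_add; first exact: card_occ_nbhd.
exact: leq_trans wk (ltnW kK).
Qed.

Lemma few_simple K k : (k <= K)%N -> (4 * (d * d.+1) + 2 * K <= N)%N ->
  (#|few k| <= (1 + 2 * (d * d.+1 + K)) ^ k * #|[set w in B | simple w]%SET|)%N.
Proof.
move=> + NK; elim: k => [_|k IH kK].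
  rewrite expn0 mul1n; apply: subset_leq_card; apply/subsetP=> w.
  by rewrite !inE leqn0 cards_eq0 bads0.
apply: leq_trans (few_step kK NK) _.
by rewrite expnS -mulnA leq_mul2l IH ?orbT // ltnW.
Qed.

End Switching.

Lemma many_simple_words d : (0 < d)%N -> exists K : nat,
  forall (Q : finType) (n : nat), (K <= #|Q|)%N ->
  (#|balanced Q n d| <= K * #|[set w in balanced Q n d | simple w]%SET|)%N.
Proof.
move=> d0; set k := (2 * (d * d.+2))%N; set A := (1 + 2 * (d * d.+1 + k))%N.
exists (2 * A ^ k + (4 * (d * d.+1) + 2 * k) + 1)%N => Q n hQ.
have cN : #|{: Q * bool}| = (#|Q| * 2)%N by rewrite card_prod card_bool.
apply: leq_trans (markov_bads _ _ _) _; rewrite -/k //; first by rewrite cN; lia.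
have := @few_simple Q n d k k (leqnn k); rewrite -/A cN.
set s := #|[set w in _ | _]%SET|; move=> /(_ _) H.
have {}H : (#|few Q n d k| <= A ^ k * s)%N by apply: H; lia.
nia.
Qed.

(** * Words with prescribed colour patterns *)

(** The set is empty or a coset of the Young subgroup of [col], whose order is the product of
    factorials. *)
Lemma card_perm_color (X J : finType) (col c : X -> J) :
  (#|[set s : {perm X} | [forall x, col (s x) == c x]]%SET| <=
   \prod_j (#|[set x | col x == j]%SET|)`!)%N.
Proof.
set S := [set s | _]%SET; have [->|[s0 s0S]] := set_0Vmem S; first by rewrite cards0.
have Sc s x : s \in S -> col (s x) = c x by rewrite inE => /forallP/(_ x)/eqP.
pose C j := [set x | col x == j]%SET.
pose h (s : {perm X}) : {ffun J -> {perm X}} := [ffun j => restr_perm (C j) (s0^-1 * s)%g].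
have stab s j : s \in S -> (s0^-1 * s)%g \in 'N(C j | 'P)%g.
  move=> sS; apply/astabsP => x; rewrite !inE /= /aperm permM (Sc s) //.
  by rewrite -(Sc s0) // permKV.
have hi : {in S &, injective h}.
  move=> s t sS tS E; apply: (mulgI s0^-1%g); apply/permP=> x.
  have := congr1 (fun f : {ffun J -> {perm X}} => f (col x) x) E.
  have xC : x \in C (col x) by rewrite inE.
  by rewrite !ffunE (restr_permE (stab s _ sS) xC) (restr_permE (stab t _ tS) xC).
rewrite -(card_in_imset hi).
apply: (@leq_trans #|family (fun j => mem [set s : {perm X} | perm_on (C j) s]%SET)|).
  apply: subset_leq_card; apply/subsetP=> _ /imsetP[s sS ->].
  by apply/familyP=> j; rewrite ffunE inE restr_perm_on.
rewrite card_family foldrE big_map big_enum /=.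
by under eq_bigr => j _ do rewrite cardsE card_perm.
Qed.

Lemma prod_pairs (S : comPzSemiRingType) (Q : finType) (F : Q * bool -> S) :
  \prod_p F p = \prod_q (F (q, false) * F (q, true)).
Proof.
rewrite (eq_bigr (fun p => F (p.1, p.2))); last by case.
rewrite -(pair_bigA _ (fun q b => F (q, b))) /=.
by apply: eq_bigr => q _; rewrite big_bool mulrC.
Qed.

Section ColorCount.
Variables (R : realFieldType) (Q : finType) (n d : nat) (J : finType).
Variables (sig : 'I_n -> J) (allowed : rel J) (x : J -> R).
Hypothesis x_ge0 : forall j, 0 <= x j.
Implicit Types (w : {ffun Q * bool -> 'I_n}) (c : {ffun Q * bool -> J}).
Local Notation B := (balanced Q n d).
Local Notation N := #|{: Q * bool}|.

Definition class_size j : nat := #|[set v | sig v == j]%SET|.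

Definition good_colors c : bool := [forall q, allowed (c (q, false)) (c (q, true))].
Definition colors w : {ffun Q * bool -> J} := [ffun p => sig (w p)].
Definition permute w (s : {perm Q * bool}) : {ffun Q * bool -> 'I_n} :=
  [ffun p => w (s p)].

Lemma card_color_class w j : w \in B ->
  #|[set p | sig (w p) == j]%SET| = (d * class_size j)%N.
Proof.
move=> /balancedP bw; rewrite -sum1_card.
rewrite (partition_big w (mem [set v | sig v == j]%SET)) /=; last first.
  by move=> p; rewrite !inE.
rewrite mulnC -sum_nat_const; apply: eq_bigr => v; rewrite inE => /eqP <-.
rewrite -(bw v) -sum1_card; apply: eq_bigl => p; rewrite !inE.
by case: (w p =P v) => [->|]; rewrite ?eqxx ?andbF.
Qed.

Lemma permute_balanced w s : (permute w s \in B) = (w \in B).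
Proof.
rewrite !inE; apply: eq_forallb => v; congr (_ == _).
rewrite -(card_imset _ (@perm_inj _ s)); apply: eq_card => p.
apply/imsetP/idP => [[y]|]; rewrite !inE ?ffunE.
  by move=> /eqP <- ->.
by move=> h; exists (s^-1 p)%g; rewrite ?inE ?ffunE permKV.
Qed.

Lemma permute_inj s : injective (permute^~ s).
Proof.
move=> w w' /ffunP E; apply/ffunP=> p.
by have := E (s^-1 p)%g; rewrite !ffunE permKV.
Qed.

(** All rearrangements of a balanced word weigh the same. So the number of good patterns with its
    class counts is at most the generating function of all good patterns divided by this weight, for
    every positive [x]. *)
Lemma weight_permute w s : w \in B ->
  \prod_p x (colors (permute w s) p) = \prod_j x j ^+ (d * class_size j).
Proof.
move=> wB; under eq_bigr => p _ do rewrite !ffunE.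
transitivity (\prod_p x (sig (w p))).
  by rewrite [RHS](reindex_inj (@perm_inj _ s)).
rewrite (partition_big (fun p => sig (w p)) xpredT) //=.
apply: eq_bigr => j _; rewrite -(card_color_class j wB) -prodr_const.
by apply: eq_big => p; rewrite ?inE // => /eqP ->.
Qed.

Lemma sum_good_weights :
  \sum_(c | good_colors c) \prod_p x (c p) =
  (\sum_i \sum_(j | allowed i j) x i * x j) ^+ #|Q|.
Proof.
transitivity (\prod_(q : Q) \sum_(i : J) \sum_(j : J) (x i * x j) *+ allowed i j).
  rewrite -(big_pair_words (fun (q : Q) i j => (x i * x j) *+ allowed i j)).
  rewrite big_mkcond /=; apply: eq_bigr => c _; rewrite prod_pairs.
  case: ifP => [/forallP H|/negbT].
    by apply: eq_bigr => q _; rewrite H.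
  rewrite negb_forall => /existsP[q H].
  by rewrite (bigD1 q) //= (negPf H) mulr0n mul0r.
rewrite prodr_const; congr (_ ^+ _); apply: eq_bigr => i _.
by rewrite [RHS]big_mkcond; apply: eq_bigr => j _; case: (allowed i j).
Qed.

(* Averaging over the permutations of the positions of each balanced word. *)
Lemma card_good_words :
  #|[set w in B | good_colors (colors w)]%SET|%:R * (N `!)%:R *
    \prod_j x j ^+ (d * class_size j) <=
  #|B|%:R * (\prod_j ((d * class_size j)`!)%:R) *
    (\sum_i \sum_(j | allowed i j) x i * x j) ^+ #|Q|.
Proof.
set W := \prod_j x j ^+ _; set Y := _ ^+ #|Q|; set F := \prod_j _%:R.
have -> : #|[set w in B | good_colors (colors w)]%SET|%:R * (N `!)%:R =
    \sum_(w in B) \sum_(s : {perm Q * bool}) (good_colors (colors (permute w s)))%:R :> R.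
  have cS : #|{perm Q * bool}| = N `!.
    rewrite -[in RHS]cardsT -card_perm; apply: eq_card => s.
    by apply/esym/subsetP=> p; rewrite !inE.
  rewrite exchange_big /= -cS -natrM mulnC -sum_nat_const natr_sum.
  apply: eq_bigr => s _.
  rewrite -sum_boolE natr_sum (reindex_inj (@permute_inj s)) /=.
  by apply: eq_bigl => w; rewrite permute_balanced.
rewrite mulr_suml -mulrA mulr_natl -sumr_const; apply: ler_sum => w wB.
have -> : (\sum_s (good_colors (colors (permute w s)))%:R) * W =
    \sum_(s | good_colors (colors (permute w s))) W.
  rewrite mulr_suml [RHS]big_mkcond /=; apply: eq_bigr => s _.
  by case: ifP; rewrite ?mul1r ?mul0r.
rewrite (partition_big (fun s => colors (permute w s)) good_colors) //=.
rewrite /Y -sum_good_weights mulr_sumr; apply: ler_sum => c gc.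
rewrite [leLHS](eq_bigr (fun=> \prod_p x (c p))); last first.
  by move=> s /andP[_ /eqP <-]; rewrite weight_permute.
rewrite sumr_const -mulr_natl; apply: ler_wpM2r; first exact: prodr_ge0.
rewrite /F -natr_prod ler_nat.
under [X in (_ <= X)%N]eq_bigr => j _ do rewrite -(card_color_class j wB).
apply: leq_trans (card_perm_color (fun p => sig (w p)) c).
apply: subset_leq_card; apply/subsetP=> s; rewrite !inE => /andP[_ /eqP <-].
by apply/forallP=> p; rewrite !ffunE.
Qed.
End ColorCount.

(** * From words to random regular graphs *)

Lemma tendsP (R : realType) (D : pred nat) (u : nat -> R) (l : R) :
  tends D u l <-> forall e, 0 < e ->
    exists N, forall n, (N <= n)%N -> D n -> `|l - u n| <= e.
Proof.
split=> [/cvgrPdist_le H e e0|H].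
  have := H e e0; rewrite near_withinE => -[N _ HN].
  by exists N => n Nn Dn; apply: HN.
apply/cvgrPdist_le => e e0; rewrite near_withinE.
by have [N HN] := H e e0; exists N => // n /= Nn Dn; apply: HN.
Qed.

Lemma tends_dist (R : realType) (D : pred nat) (u v : nat -> R) (l : R) n0 :
  (v n @[n --> \oo] --> (0 : R))%classic ->
  (forall n, (n0 <= n)%N -> D n -> `|l - u n| <= v n) -> tends D u l.
Proof.
move=> /cvgrPdist_le v0 H; apply/tendsP => e e0.
have [N _ HN] := v0 e e0; exists (maxn n0 N) => n; rewrite geq_max => /andP[hn hN] Dn.
apply: le_trans (H n hn Dn) _; apply: le_trans (HN n hN).
by rewrite /= sub0r normrN ler_norm.
Qed.

Lemma prob_uniform (R : realType) (T : finType) (S : {set T}) (P : pred T) :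
  prob (uniform R S) P = #|[set x in S | P x]%SET|%:R / #|S|%:R.
Proof.
rewrite /prob -sum_boolE natr_sum mulr_suml big_mkcond [RHS]big_mkcond /=.
apply: eq_bigr => x _; rewrite ffunE; case: (P x); case: (x \in S) => //.
- by rewrite mul1r.
- by rewrite mul0r.
Qed.

Lemma prob_uniform_compl (R : realType) (T : finType) (S : {set T}) (P : pred T) :
  (0 < #|S|)%N ->
  1 - prob (uniform R S) P = prob (uniform R S) (fun x => ~~ P x).
Proof.
move=> S0; have Sne : #|S|%:R != 0 :> R by rewrite pnatr_eq0 -lt0n.
rewrite !prob_uniform; apply: (mulIf Sne); rewrite mulrBl mul1r !mulfVK //.
apply/eqP; rewrite subr_eq -natrD eqr_nat; apply/eqP.
rewrite -(cardsID [set x | P x]%SET S) addnC; congr (_ + _)%N.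
  by apply: eq_card => x; rewrite !in_set andbC.
by apply: eq_card => x; rewrite !in_set.
Qed.

(** The word of [d] copies of one perfect matching. With [many_simple_words] it yields a simple
    word, hence a regular graph, so that the uniform law on regular graphs has total mass 1. *)
Lemma balanced_exists (n d : nat) : ~~ odd n ->
  exists w, w \in balanced ('I_d * 'I_(n./2))%type n d.
Proof.
move=> en; have lt_n (p : 'I_d * 'I_(n./2) * bool) : (p.1.2.*2 + p.2 < n)%N.
  by case: p => [[j [i hi]] b] /=; case: b; lia.
exists [ffun p => Ordinal (lt_n p)]; apply/balancedP=> v.
have hv : (v./2 < n./2)%N by have := ltn_ord v; lia.
transitivity #|[set ((j, Ordinal hv), odd v) | j : 'I_d]%SET|.
  apply: eq_card => [[[j i] b]]; rewrite inE ffunE.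
  apply/eqP/imsetP => [/(congr1 val) /= E|[j' _ [-> -> ->]]].
    exists j => //; congr (_, _, _); first apply: val_inj; rewrite /= -E.
      by rewrite addnC half_bit_double.
    by rewrite oddD odd_double /=; case: b E.
  by apply: val_inj; rewrite /= addnC odd_double_half.
by rewrite card_imset ?card_ord // => j j' [].
Qed.

Lemma whp_of_words (R : realType) (d : nat) (P : forall n, pred (graph n))
    (v : nat -> R) (n0 : nat) : odd d -> (v n @[n --> \oo] --> (0 : R))%classic ->
  (forall (Q : finType) n, (n0 <= n)%N -> (#|Q| * 2 = n * d)%N ->
    #|[set w in balanced Q n d | simple w && ~~ P n (word_graph w)]%SET|%:R
      <= v n * #|balanced Q n d|%:R) ->
  whp R d P.
Proof.
move=> od v0 H; have d0 : (0 < d)%N by case: (d) od.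
have [K HK] := many_simple_words d0.
apply: (@tends_dist _ _ _ (fun n => K%:R * v n) 1 (n0 + 2 * K)).
  have := cvgM (cvg_cst (K%:R : R)) v0; rewrite mulr0; exact.
move=> n hn; rewrite /regular_size oddM od andbT => en.
pose Q := ('I_d * 'I_(n./2))%type.
have cQ : (#|{: Q}| * 2 = n * d)%N.
  by rewrite card_prod !card_ord -[in RHS](even_halfK en) -muln2; lia.
have [w0 w0B] : exists w, w \in balanced Q n d := balanced_exists d en.
have B0 : (0 < #|balanced Q n d|)%N by apply/card_gt0P; exists w0.
have {}H := H Q n (leq_trans (leq_addr _ _) hn) cQ.
have {}HK : (#|balanced Q n d| <= K * #|[set w in balanced Q n d | simple w]%SET|)%N.
  apply: HK; rewrite -(leq_pmul2r (isT : 0 < 2)%N) cQ.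
  apply: (@leq_trans n); last by rewrite leq_pmulr.
  by rewrite mulnC (leq_trans (leq_addl _ _) hn).
set B := balanced Q n d in B0 H HK.
pose c := ((#|{: Q}|)`! * 2 ^ #|{: Q}|)%N.
have c0 : (0 < c)%N by rewrite muln_gt0 fact_gt0 expn_gt0.
(* Every regular graph arises from exactly [c] simple words, so ratios of word counts are ratios of
   graph counts. *)
have count (F : pred (graph n)) :
    #|[set w in B | simple w && F (word_graph w)]%SET| =
    (#|[set E in regular_graphs n d | F E]%SET| * c)%N.
  rewrite -sum1_card.
  rewrite (partition_big (@word_graph Q n)
    (mem [set E in regular_graphs n d | F E]%SET)) /=; last first.
    move=> w; rewrite !in_set => /andP[wB /andP[sw ->]].
    by rewrite simple_balanced_regular // in_set wB.
  rewrite -sum_nat_const; apply: eq_bigr => E; rewrite !in_set => /andP[rE FE].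
  rewrite /c -(card_words_of_graph cQ rE) -sum1_card; apply: eq_bigl => w.
  rewrite !in_set; case: (_ =P E) => [e|]; rewrite ?andbF // !andbT e FE andbT.
  case sw : (simple w); rewrite ?andbF // andbT.
  by have := simple_balanced_regular d sw; rewrite in_set e rE => <-.
have cR : #|[set w in B | simple w]%SET| = (#|regular_graphs n d| * c)%N.
  have := count xpredT; rewrite (_ : [set E in _ | _]%SET = regular_graphs n d).
    by move=> <-; apply: eq_card => w; rewrite !in_set andbT.
  by apply/setP=> E; rewrite !in_set andbT.
set S := regular_graphs n d in cR count *.
have S0 : (0 < #|S|)%N by move: HK; rewrite cR; nia.
rewrite prob_uniform_compl // prob_uniform.
rewrite ger0_norm ?divr_ge0 // ler_pdivrMr ?ltr0n //.
rewrite (count (fun E => ~~ P n E)) in H; rewrite cR in HK.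
have cp : 0 < c%:R :> R by rewrite ltr0n.
rewrite -(ler_pM2r cp) -natrM; apply: (le_trans H).
have v_ge0 : 0 <= v n.
  have : 0 <= v n * #|B|%:R := le_trans (ler0n _ _) H.
  by rewrite pmulr_lge0 // ltr0n.
apply: le_trans (ler_wpM2l v_ge0 (_ : _ <= (K * (#|S| * c))%:R)) _.
  by rewrite ler_nat.
by rewrite !natrM; lra.
Qed.

(** * Proper 3-colourings *)

Section Stirling.
Variable R : realType.
Local Notation e := (expR 1 : R).

(** From [1 + 1/k <= expR (1/k)]. With the companion bound from [1 - 1/(k+1) <= expR (-1/(k+1))],
    these are the inductive steps for [(k/e)^k <= k! <= e (k+1) (k/e)^k]. *)
Lemma expr_succ_le (k : nat) : k.+1%:R ^+ k <= k%:R ^+ k * e.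
Proof.
case: k => [|k]; first by rewrite !expr0 mul1r; have := expR_ge1Dx (1 : R); lra.
have -> : e = expR (k.+1%:R^-1) ^+ k.+1 by rewrite -expRM_natl divff // pnatr_eq0.
rewrite -exprMn; apply: lerXn2r; rewrite ?nnegrE ?mulr_ge0 ?expR_ge0 //.
apply: le_trans (ler_wpM2l (ler0n _ _) (expR_ge1Dx _)).
by rewrite mulrDr mulr1 divff ?pnatr_eq0 // natr1.
Qed.

Lemma expr_succ_ge (k : nat) : e * k%:R ^+ k.+1 <= k.+1%:R ^+ k.+1.
Proof.
rewrite mulrC -ler_pdivlMr ?expR_gt0 //.
have -> : e^-1 = expR (- k.+1%:R^-1) ^+ k.+1.
  by rewrite -expRM_natl mulrN divff ?pnatr_eq0 // expRN.
rewrite -exprMn; apply: lerXn2r; rewrite ?nnegrE ?mulr_ge0 ?expR_ge0 //.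
apply: le_trans (ler_wpM2l (ler0n _ _) (expR_ge1Dx _)).
rewrite mulrDr mulr1 mulrN divff ?pnatr_eq0 // -natr1; lra.
Qed.

Lemma fact_lower (k : nat) : k%:R ^+ k <= (k`!)%:R * e ^+ k.
Proof.
elim: k => [|k IH]; first by rewrite !expr0 mulr1.
rewrite factS natrM !exprS -mulrA ler_wpM2l //.
apply: le_trans (expr_succ_le k) _.
have := ler_wpM2r (expR_ge0 1) IH; lra.
Qed.

Lemma fact_upper (k : nat) :
  (k`!)%:R * e ^+ k <= e * k.+1%:R * k%:R ^+ k.
Proof.
have e1 : 1 <= e by have := expR_ge1Dx (1 : R); lra.
case: k => [|k]; first by rewrite fact0 !expr0; lra.
(* For positive arguments the induction gives the factor [e k]; the successor in the statement
   covers [k = 0]. *)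
apply: (@le_trans _ _ (e * k.+1%:R * k.+1%:R ^+ k.+1)); last first.
  apply: ler_wpM2r; first exact: exprn_ge0.
  by apply: ler_wpM2l; [exact: expR_ge0 | rewrite ler_nat].
elim: k => [|k IH]; first by rewrite factS fact0 muln1 !expr1; lra.
rewrite factS natrM.
have H := ler_wpM2l (mulr_ge0 (ler0n R k.+2) (expR_ge0 1)) IH.
have := ler_wpM2l (mulr_ge0 (ler0n R k.+2) (expR_ge0 1)) (expr_succ_ge k.+1).
move: H; rewrite [e ^+ k.+2]exprS [k.+1%:R ^+ k.+2]exprS.
set a := _ ^+ _; set b := _ ^+ _; set c := _ ^+ _; lra.
Qed.

Lemma sum_class_size n (J : finType) (sig : 'I_n -> J) :
  (\sum_j class_size sig j = n)%N.
Proof.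
rewrite -[RHS]card_ord -sum1_card (partition_big sig xpredT) //=.
by apply: eq_bigr => j _; rewrite /class_size -sum1_card; apply: eq_bigl => v; rewrite inE.
Qed.

Lemma class_size_le n (J : finType) (sig : 'I_n -> J) j : (class_size sig j <= n)%N.
Proof. by rewrite -[X in (_ <= X)%N](sum_class_size sig) (bigD1 j) //= leq_addr. Qed.

(** Stirling on both sides of [card_good_words]. As the class sizes add up to [n], the powers of [e]
    and of [d] cancel, and each class leaves one factor linear in [n * d]. *)
Lemma card_good_words_entropy (Q : finType) (n d : nat) (J : finType)
    (sig : 'I_n -> J) (allowed : rel J) (x : J -> R) :
  (0 < d)%N -> (forall j, 0 <= x j) -> (#|Q| * 2 = n * d)%N ->
  #|[set w in balanced Q n d | good_colors allowed (colors sig w)]%SET|%:R *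
    n%:R ^+ (n * d) * \prod_j x j ^+ (d * class_size sig j) <=
  #|balanced Q n d|%:R * (e * (n * d).+1%:R) ^+ #|J| *
    \prod_j (class_size sig j)%:R ^+ (d * class_size sig j) *
    (\sum_i \sum_(j | allowed i j) x i * x j) ^+ #|Q|.
Proof.
move=> d0 x0 cQ; have := @card_good_words R Q n d J sig allowed x x0.
have -> : #|{: Q * bool}| = (n * d)%N by rewrite card_prod card_bool cQ.
set G := #|[set w in _ | _]%SET|%:R; set B := #|balanced _ _ _|%:R.
set W := \prod_j x j ^+ _; set Y := _ ^+ #|Q|; set F := \prod_j _%:R => H.
have W0 : 0 <= W by apply: prodr_ge0 => j _; apply: exprn_ge0.
have Y0 : 0 <= Y.
  by apply: exprn_ge0; apply: sumr_ge0 => i _; apply: sumr_ge0 => j _; apply: mulr_ge0.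
have dn0 : 0 < d%:R ^+ (n * d) :> R by rewrite exprn_gt0 // ltr0n.
rewrite -(ler_pM2l dn0).
have -> : d%:R ^+ (n * d) * (G * n%:R ^+ (n * d) * W) =
   G * (n * d)%:R ^+ (n * d) * W by rewrite natrM exprMn; ring.
apply: (@le_trans _ _ (G * (((n * d)`!)%:R * e ^+ (n * d)) * W)).
  by apply: ler_wpM2r => //; apply: ler_wpM2l => //; exact: fact_lower.
have -> : G * ((n * d)`!%:R * e ^+ (n * d)) * W =
   e ^+ (n * d) * (G * (n * d)`!%:R * W) by ring.
apply: (@le_trans _ _ (e ^+ (n * d) * (B * F * Y))).
  by apply: ler_wpM2l H; rewrite exprn_ge0 // expR_ge0.
have -> : e ^+ (n * d) * (B * F * Y) = B * (F * e ^+ (n * d)) * Y by ring.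
rewrite [leRHS]mulrA; apply: ler_wpM2r => //.
have -> : forall (a b c f : R), f * (a * b * c) = a * (b * (f * c)) by move=> *; ring.
apply: ler_wpM2l => //.
have expn_sum (y : R) : y ^+ (n * d) = \prod_(j : J) y ^+ (d * class_size sig j).
  rewrite -[in LHS](sum_class_size sig) mulnC big_distrr /=.
  by elim/big_rec2: _ => [|j a b _ <-]; rewrite ?expr0 // exprD.
rewrite !expn_sum /F -!big_split /= -prodr_const -big_split /=.
apply: ler_prod => j _; apply/andP; split.
  by rewrite mulr_ge0 // exprn_ge0 // expR_ge0.
apply: le_trans (fact_upper _) _.
rewrite -exprMn -natrM; apply: ler_wpM2r; first exact: exprn_ge0.
apply: ler_wpM2l; first exact: expR_ge0.
by rewrite ler_nat ltnS mulnC leq_mul2r class_size_le orbT.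
Qed.

End Stirling.

Section ThreeColors.
Variable R : realType.

(** With the class sizes as weights the two products over the classes agree (an empty class
    contributes [0 ^ 0 = 1]). What remains is the Cauchy-Schwarz bound [2/3 n^2] on the sum of
    [a_i a_j] over [i != j]. *)
Lemma proper_words_le (Q : finType) (n d : nat) (sig : 'I_n -> 'I_3) :
  (0 < d)%N -> (0 < n)%N -> (#|Q| * 2 = n * d)%N ->
  #|[set w in balanced Q n d |
      good_colors (fun i j => i != j) (colors sig w)]%SET|%:R <=
  #|balanced Q n d|%:R * (expR 1 * (n * d).+1%:R) ^+ 3 * (2 / 3) ^+ #|Q| :> R.
Proof.
move=> d0 n0 cQ.
have := @card_good_words_entropy R Q n d _ sig (fun i j => i != j)
  (fun j => (class_size sig j)%:R) d0 (fun j => ler0n _ _) cQ.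
rewrite card_ord; set W := \prod_j _ => H.
have W0 : 0 < W.
  apply: prodr_gt0 => j _; case: (posnP (class_size sig j)) => [->|h].
    by rewrite muln0 expr0.
  by rewrite exprn_gt0 // ltr0n.
have n0R : 0 < n%:R ^+ (n * d) :> R by rewrite exprn_gt0 // ltr0n.
rewrite -(ler_pM2r n0R) -(ler_pM2r W0); apply: (le_trans H).
set Y := (_ ^+ #|Q| in leLHS).
suff HY : Y <= (2 / 3) ^+ #|Q| * n%:R ^+ (n * d).
  apply: (@le_trans _ _ (#|balanced Q n d|%:R * (expR 1 * (n * d).+1%:R) ^+ 3 * W *
      ((2 / 3) ^+ #|Q| * n%:R ^+ (n * d)))); last by lra.
  apply: ler_wpM2l => //; apply: mulr_ge0 (ltW W0); apply: mulr_ge0 => //.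
  by rewrite exprn_ge0 // mulr_ge0 // expR_ge0.
rewrite /Y -cQ mulnC exprM -exprMn; apply: lerXn2r; rewrite ?nnegrE.
- by apply: sumr_ge0 => i _; apply: sumr_ge0 => j _; apply: mulr_ge0.
- by apply: mulr_ge0; [lra | exact: exprn_ge0].
have -> : n%:R = \sum_j (class_size sig j)%:R :> R.
  by rewrite -natr_sum sum_class_size.
under eq_bigr => i _ do rewrite big_mkcond /=.
rewrite !big_ord_recl !big_ord0 /=.
set a : R := _%:R; set b : R := _%:R; set c : R := _%:R.
by have := sqr_ge0 (a - b); have := sqr_ge0 (b - c); have := sqr_ge0 (a - c); lra.
Qed.

Lemma colorable3 n (E : graph n) : ~~ (4 <= chromatic_number E)%N -> colorable E 3.
Proof.
rewrite -ltnNge /chromatic_number; case: ex_minnP => m /existsP[f /forallP Hf] _ m4.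
apply/existsP; exists [ffun v => widen_ord (m4 : (m <= 3)%N) (f v)].
apply/forallP=> u; apply/forallP=> v; apply/implyP=> auv; rewrite !ffunE.
have /forallP/(_ v)/implyP/(_ auv) := Hf u; apply: contra => /eqP/(congr1 val) /= h.
by apply/eqP; apply: val_inj.
Qed.

(** [128 / 243 = 3 ^ 2 * (2 / 3) ^ 7] is the union bound per pair of vertices. It is at most
    [(5 / 6) ^ 3 * (24 / 25) ^ 2], so that each of the three linear factors is absorbed by one
    [(5 / 6) ^ h]. *)
Lemma cube_geometric (h : nat) :
  h.+1%:R ^+ 3 * (128 / 243) ^+ h <= 125 * (24 / 25) ^+ (h * 2) :> R.
Proof.
have B : h.+1%:R * (5 / 6) ^+ h <= 5 :> R.
  have P : 0 < (6 / 5) ^+ h :> R by apply: exprn_gt0; lra.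
  have -> : (5 / 6) ^+ h = ((6 / 5) ^+ h)^-1 :> R by rewrite -exprVn; congr (_ ^+ _); field.
  rewrite ler_pdivrMr //; elim: h {P} => [|h IH]; first by rewrite expr0; lra.
  by rewrite exprS -natr1; set y := _ ^+ h in IH *; have : 1 <= y; [apply: exprn_ege1; lra | lra].
have B0 : 0 <= h.+1%:R * (5 / 6) ^+ h :> R by rewrite mulr_ge0 // exprn_ge0 //; lra.
have B3 : (h.+1%:R * (5 / 6) ^+ h) ^+ 3 <= 5 ^+ 3 :> R.
  by apply: lerXn2r; rewrite ?nnegrE //; lra.
have Q1 : ((128 / 243) : R) ^+ h <= ((5 / 6) ^+ 3 * (24 / 25) ^+ 2) ^+ h.
  by apply: lerXn2r; rewrite ?nnegrE; rewrite ?mulr_ge0 ?exprn_ge0 //; lra.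
apply: (@le_trans _ _ (h.+1%:R ^+ 3 * ((5 / 6) ^+ 3 * (24 / 25) ^+ 2) ^+ h)).
  by apply: ler_wpM2l => //; exact: exprn_ge0.
rewrite exprMn mulrA -!exprM [(3 * h)%N]mulnC [(2 * h)%N]mulnC [_ ^+ (h * 3)]exprM -exprMn.
apply: ler_wpM2r; first by apply: exprn_ge0; lra.
by apply: le_trans B3 _; lra.
Qed.

Lemma whp_chromatic : whp R 7 (fun n E => (4 <= chromatic_number E)%N).
Proof.
(* [14] comes from [7 n + 1 <= 14 (n/2 + 1)] and [125] from [cube_geometric]. *)
pose C : R := (expR 1 * 14) ^+ 3 * 125.
apply: (@whp_of_words R 7 _ (fun n => C * (24 / 25) ^+ n) 1) => //.
  have q1 : `|24 / 25| < 1 :> R by rewrite ger0_norm; lra.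
  have := cvgM (cvg_cst C) (cvg_expr q1); rewrite mulr0; exact.
move=> Q n n0 cQ.
have [h nE] : exists h, n = (h * 2)%N by exists n./2; lia.
have QE : #|Q| = (7 * h)%N by lia.
set BB := balanced Q n 7.
apply: (@le_trans _ _ (\sum_(f : {ffun 'I_n -> 'I_3})
   #|[set w in BB | good_colors (fun i j => i != j) (colors f w)]%SET|%:R)).
  rewrite -natr_sum ler_nat; under eq_bigr => f _ do rewrite -sum1dep_card.
  rewrite -sum1dep_card (exchange_big_dep (mem BB)) /=; last by move=> f w _ /andP[].
  rewrite big_mkcond [X in (_ <= X)%N]big_mkcond; apply: leq_sum => w _.
  case: (w \in BB) => //=; case: ifP => // /andP[sw /colorable3 /existsP[f /forallP Hf]].
  rewrite (bigD1 f) //=; apply/forallP=> q; rewrite !ffunE.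
  have /forallP/(_ (w (q, true)))/implyP := Hf (w (q, false)); apply.
  by rewrite /adj (simple_loopless (q, false) sw) /=; apply: imset_f.
apply: (@le_trans _ _ (\sum_(f : {ffun 'I_n -> 'I_3})
   #|BB|%:R * (expR 1 * (n * 7).+1%:R) ^+ 3 * (2 / 3) ^+ #|Q|)).
  by apply: ler_sum => f _; apply: proper_words_le.
rewrite sumr_const card_ffun !card_ord -[leLHS]mulr_natl natrX QE.
move: (#|BB|%:R : R) (ler0n R #|BB|) => b b0; rewrite nE {BB n0 cQ QE nE}.
have -> : (3 : R) ^+ (h * 2) * (b * (expR 1 * (h * 2 * 7).+1%:R) ^+ 3 * (2 / 3) ^+ (7 * h)) =
   b * (expR 1 * (h * 2 * 7).+1%:R) ^+ 3 * (128 / 243) ^+ h.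
  have -> : (128 / 243 : R) = 3 ^+ 2 * (2 / 3) ^+ 7 by field.
  rewrite [(3 ^+ 2 * _) ^+ h]exprMn -!exprM [(2 * h)%N]mulnC.
  by rewrite mulrCA mulrA; ring.
rewrite [leRHS]mulrC -mulrA; apply: ler_wpM2l => //.
apply: (@le_trans _ _ ((expR 1 * (14 * h.+1%:R)) ^+ 3 * (128 / 243) ^+ h)).
  apply: ler_wpM2r; first by apply: exprn_ge0; lra.
  apply: lerXn2r; rewrite ?nnegrE ?mulr_ge0 ?expR_ge0 //.
  by apply: ler_wpM2l; rewrite ?expR_ge0 // -natrM ler_nat; lia.
have := ler_wpM2l (exprn_ge0 3 (mulr_ge0 (expR_ge0 (1 : R)) (ler0n R 14))) (cube_geometric h).
set q := (128 / 243) ^+ h; set r := (24 / 25) ^+ _ => H.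
have -> : (expR 1 * (14 * h.+1%:R)) ^+ 3 * q = (expR 1 * 14) ^+ 3 * (h.+1%:R ^+ 3 * q) by ring.
by apply: (le_trans H); rewrite /C mulrA.
Qed.

End ThreeColors.

(** * Spectra of real symmetric matrices *)

Section Spectrum.
Variable R : realType.

Lemma char_poly_similar (F : fieldType) n (P D : 'M[F]_n) : P \in unitmx ->
  char_poly (invmx P *m D *m P) = char_poly D.
Proof.
move=> uP; pose pC := map_mx (@polyC F).
have uPC : pC _ _ (invmx P) *m pC _ _ P = 1%:M.
  by rewrite /pC -map_mxM mulVmx // map_mx1.
have E : char_poly_mx (invmx P *m D *m P) = pC _ _ (invmx P) *m char_poly_mx D *m pC _ _ P.
  rewrite /char_poly_mx mulmxBr mulmxBl !map_mxM; congr (_ - _).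
  by rewrite -mulmxA mul_scalar_mx -scalemxAr uPC -mul_scalar_mx mulmx1.
rewrite /char_poly E !det_mulmx mulrC mulrA -det_mulmx.
by rewrite (mulmx1C uPC) det1 mul1r.
Qed.

Section Symmetric.
Variables (n : nat) (A : 'M[R]_n).
Hypothesis symA : A^T = A.

(** The spectral theorem is applied to the Hermitian image of [A] over the complex numbers, whose
    diagonal form is real. Only consequences that make sense over [R] are brought back along the
    embedding. *)
Lemma symmetric_diagonalization : exists d : 'I_n -> R,
  [/\ char_poly A = \prod_i ('X - (d i)%:P),
      \tr (A *m A) = \sum_i d i ^+ 2 &
      forall c, (forall i, c <= d i) -> forall u : 'rV[R]_n,
        c * (u *m u^T) 0 0 <= (u *m A *m u^T) 0 0].
Proof.
pose toC := real_complex R; pose AC := map_mx toC A.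
have AC_real : AC \is a mxOver Num.real.
  by apply/mxOverP=> i j; rewrite mxE complex_real.
have AC_herm : AC \is hermsymmx.
  apply: realsym_hermsym AC_real; apply/is_hermitianmxP.
  by rewrite expr0 scale1r map_mx_id // map_trmx symA.
have /orthomx_spectralP := hermitian_normalmx AC_herm.
have /mxOverP D_real := hermitian_spectral_diag_real AC_herm.
have uP := spectral_unit AC; have UP := spectral_unitarymx AC.
move: (spectralmx AC) (spectral_diag AC) D_real uP UP => P D D_real uP UP AE.
pose d i := complex.Re (D 0 i).
have dE i : toC (d i) = D 0 i by rewrite /toC /d RRe_real.
exists d; split.
- apply: (@map_poly_inj _ _ toC).
  rewrite map_char_poly -/AC AE char_poly_similar // char_poly_trig ?diag_mx_is_trig //.
  rewrite map_prod_XsubC; apply: eq_bigr => i _.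
  by rewrite mxE eqxx mulr1n -dE.
- apply: (@complexI R); rewrite -/toC.
  transitivity (\tr (AC *m AC)); first by rewrite -map_mxM trace_map_mx.
  rewrite AE -!mulmxA mulKVmx // mxtrace_mulC mulmxA mulmxK // mulmx_diag.
  rewrite mxtrace_diag /toC rmorph_sum; apply: eq_bigr => i _.
  by rewrite mxE rmorphXn /= -/toC dE expr2.
move=> c cd u; rewrite -lecR rmorphM /= -/toC.
pose uC := map_mx toC u.
have uCE : uC^T = map_mx Num.conj uC^T.
  by apply/matrixP=> i j; rewrite !mxE conj_Creal // complex_real.
(* The coordinates of [u] in the orthonormal eigenbasis, where both quadratic forms are diagonal. *)
pose y := uC *m map_mx Num.conj P^T.
have yE : map_mx Num.conj y^T = P *m uC^T.
  by rewrite trmx_mul map_mxM -uCE map_trmx trmxK -map_mx_comp map_mx_id // => z; rewrite /= conjCK.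
have -> : toC ((u *m A *m u^T) 0 0) = \sum_i D 0 i * `|y 0 i| ^+ 2.
  transitivity ((uC *m AC *m uC^T) 0 0).
    by rewrite /uC /AC map_trmx -!map_mxM [RHS]mxE.
  rewrite AE invmx_unitary // !mulmxA -/y -mulmxA -yE mxE.
  apply: eq_bigr => i _; rewrite mul_mx_diag !mxE normCK; ring.
have -> : toC ((u *m u^T) 0 0) = \sum_i `|y 0 i| ^+ 2.
  transitivity ((uC *m uC^T) 0 0).
    by rewrite /uC map_trmx -!map_mxM [RHS]mxE.
  transitivity ((y *m map_mx Num.conj y^T) 0 0).
    by rewrite yE mulmxA /y mulmxKtV.
  by rewrite mxE; apply: eq_bigr => i _; rewrite !mxE normCK.
rewrite mulr_sumr; apply: ler_sum => i _; apply: ler_wpM2r; first exact: exprn_ge0.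
by rewrite -dE lecR.
Qed.

(** The sorted diagonal is a witness, so [xget] does not fall back on its default. *)
Lemma eigenvaluesP :
  sorted >=%R (eigenvalues A) /\
  char_poly A = \prod_(x <- eigenvalues A) ('X - x%:P).
Proof.
have [d [cd _ _]] := symmetric_diagonalization.
apply: (@xgetPex _ [::] [set s : seq R | sorted >=%R s /\
          char_poly A = \prod_(x <- s) ('X - x%:P)]%classic).
exists (sort >=%R [seq d i | i <- index_enum 'I_n]); split.
  by apply: sort_sorted => x y; rewrite orbC le_total.
by rewrite (perm_big _ (permEl (perm_sort _ _))) /= big_map.
Qed.

Lemma size_eigenvalues : size (eigenvalues A) = n.
Proof.
have [_ /(congr1 (fun p : {poly R} => size p))] := eigenvaluesP.
by rewrite size_char_poly size_prod_XsubC => -[].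
Qed.

Lemma eigenvalues_spec :
  \tr (A *m A) = \sum_(x <- eigenvalues A) x ^+ 2 /\
  forall c, (forall x, x \in eigenvalues A -> c <= x) -> forall u : 'rV[R]_n,
    c * (u *m u^T) 0 0 <= (u *m A *m u^T) 0 0.
Proof.
have [d [cd td rd]] := symmetric_diagonalization; have [_ cE] := eigenvaluesP.
have pE : perm_eq (eigenvalues A) [seq d i | i <- index_enum 'I_n].
  by apply: prod_XsubC_eq; rewrite -cE cd big_map.
split=> [|c H]; first by rewrite (perm_big _ pE) big_map td.
apply: rd => i; apply: H; rewrite (perm_mem pE); apply: map_f.
exact: mem_index_enum.
Qed.

Lemma eigenvalues_vector x : x \in eigenvalues A ->
  exists2 v : 'rV[R]_n, v *m A = x *: v & v != 0.
Proof.
move=> xA; apply/eigenvalueP; rewrite eigenvalue_root_char.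
by have [_ ->] := eigenvaluesP; rewrite root_prod_XsubC.
Qed.

Lemma mem_lambda i : (0 < i <= n)%N -> lambda A i \in eigenvalues A.
Proof. by case: i => // i h; rewrite mem_nth // size_eigenvalues. Qed.

Lemma lambda_anti i j : (0 < i <= j)%N -> (j <= n)%N -> lambda A j <= lambda A i.
Proof.
case: i j => [//|i] [//|j] /= ij jn; have [so _] := eigenvaluesP.
have tr : transitive (>=%R : rel R) by move=> y x z h1 h2; apply: le_trans h2 h1.
have rf : reflexive (>=%R : rel R) by move=> x; apply: lexx.
by apply: (sorted_leq_nth tr rf 0 so); rewrite ?inE ?size_eigenvalues //; lia.
Qed.

Lemma lambda_min x : x \in eigenvalues A -> lambda A n <= x.
Proof.
move=> xA; have ix : (index x (eigenvalues A) < n)%N.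
  by rewrite -[X in (_ < X)%N]size_eigenvalues index_mem.
by rewrite -(nth_index 0 xA); apply: (@lambda_anti (index x (eigenvalues A)).+1).
Qed.

Lemma rayleigh (u : 'rV[R]_n) :
  lambda A n * (u *m u^T) 0 0 <= (u *m A *m u^T) 0 0.
Proof. by have [_] := eigenvalues_spec; apply; apply: lambda_min. Qed.

End Symmetric.
End Spectrum.

(** * Hoffman's bound *)

Lemma adj_sym n (E : graph n) : symmetric (adj E).
Proof. by move=> u v; rewrite /adj eq_sym setUC. Qed.

Lemma degree_regular n d (E : graph n) u : is_regular d E ->
  #|[set v | adj E u v]%SET| = d.
Proof.
move=> /andP[/forall_inP E2 /forallP/(_ u)/eqP <-].
rewrite -(@card_in_imset _ _ (fun v => [set u; v]%SET)); last first.
  move=> v v'; rewrite !inE => /andP[nv _] /andP[nv' _] /set2_eqP[[_ //]|[e _]].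
  by rewrite e eqxx in nv'.
apply: eq_card => e; rewrite inE; apply/imsetP/andP => [[v]|[eE ue]].
  by rewrite inE => /andP[_ h] ->; rewrite h !inE eqxx.
have /cards2P[x [y [nxy exy]]] : #|e| == 2%N by apply: E2.
move: ue eE; rewrite exy !inE => /orP[]/eqP -> h.
  by exists y; rewrite // inE /adj nxy.
by exists x; [rewrite inE /adj eq_sym nxy setUC | rewrite setUC].
Qed.

Section Hoffman.
Variables (R : realType) (n d : nat) (E : graph n).
Hypothesis rE : is_regular d E.
Local Notation A := (adjacency R E).

Lemma adjacency_sym : A^T = A.
Proof. by apply/matrixP=> u v; rewrite !mxE adj_sym. Qed.

Lemma adjacency_row u : \sum_v A u v = d%:R.
Proof.
rewrite -(degree_regular u rE) -sum_bool_cardT natr_sum.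
by apply: eq_bigr => v _; rewrite mxE.
Qed.

(* The test vectors are [c 1_{V_j} - 1] for the colour classes [V_j]. *)
Lemma hoffman_inequality (c : nat) : (0 < n)%N -> colorable E c ->
  (0 < c)%N /\ d%:R <= - lambda A n * (c%:R - 1) :> R.
Proof.
move=> n0 /existsP[f /forallP Hf].
have c0 : (0 < c)%N by apply: leq_ltn_trans (ltn_ord (f (Ordinal n0))).
split=> //; pose x v j : R := c%:R * (f v == j)%:R - 1.
pose u j : 'rV[R]_n := \row_v x v j.
have S1 v j0 : \sum_(j < c) ((f v == j)%:R * (j0 == j)%:R) = (f v == j0)%:R :> R.
  rewrite (bigD1 j0) //= eqxx mulr1 big1 ?addr0 // => j nj.
  by rewrite [j0 == j]eq_sym (negPf nj) mulr0.
have S0 v : \sum_(j < c) (f v == j)%:R = 1 :> R.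
  rewrite (bigD1 (f v)) //= eqxx big1 ?addr0 // => j nj.
  by rewrite eq_sym (negPf nj).
(* Summing over the colours leaves only the test whether two vertices share a colour, which fails
   across edges; so [Q1] and [Q2] are exact whatever the class sizes. *)
have X v w : \sum_(j < c) x v j * x w j = c%:R ^+ 2 * (f v == f w)%:R - c%:R.
  have Xj j : x v j * x w j = c%:R ^+ 2 * ((f v == j)%:R * (f w == j)%:R)
      - c%:R * (f v == j)%:R - c%:R * (f w == j)%:R + 1 by rewrite /x; ring.
  under eq_bigr => j _ do rewrite Xj.
  rewrite big_split !sumrB -!mulr_sumr S1 !S0 sumr_const card_ord /=; ring.
have Q1 : \sum_j (u j *m (u j)^T) 0 0 = n%:R * (c%:R ^+ 2 - c%:R).
  under eq_bigr => j _ do rewrite mxE.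
  rewrite exchange_big /= mulr_natl -[n in RHS]card_ord -sumr_const.
  apply: eq_bigr => v _; under eq_bigr => j _ do rewrite !mxE.
  by rewrite X eqxx mulr1.
have Q2 : \sum_j (u j *m A *m (u j)^T) 0 0 = - (n%:R * (c%:R * d%:R)).
  have Ej j : (u j *m A *m (u j)^T) 0 0 = \sum_v \sum_w A v w * (x v j * x w j).
    rewrite mxE exchange_big /=; apply: eq_bigr => w _.
    rewrite mxE mulr_suml; apply: eq_bigr => v _; rewrite !mxE; ring.
  under eq_bigr => j _ do rewrite Ej.
  rewrite exchange_big /= mulr_natl -mulNrn -[n in RHS]card_ord -sumr_const.
  apply: eq_bigr => v _; rewrite exchange_big /=.
  transitivity (\sum_w - (c%:R * A v w)); last first.
    by rewrite sumrN -mulr_sumr adjacency_row.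
  apply: eq_bigr => w _; rewrite -mulr_sumr X mxE.
  case avw : (adj E v w); last by rewrite mul0r mulr0 oppr0.
  have /forallP/(_ w)/implyP/(_ avw)/negPf -> := Hf v; rewrite mulr0n mulr1n; ring.
have : lambda A n * (n%:R * (c%:R ^+ 2 - c%:R)) <= - (n%:R * (c%:R * d%:R)).
  by rewrite -Q1 -Q2 mulr_sumr; apply: ler_sum => j _; apply: rayleigh adjacency_sym _.
have ncp : 0 < n%:R * c%:R :> R by rewrite mulr_gt0 ?ltr0n.
move=> H; rewrite -(ler_pM2l ncp); move: H; lra.
Qed.

Lemma hoffman_bound_le (c : nat) : (0 < n)%N -> colorable E c ->
  hoffman_bound R d E <= c%:Z.
Proof.
move=> n0 /(hoffman_inequality n0)[c0 H]; rewrite /hoffman_bound addrC -lerBrDr.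
rewrite ceil_le_int rmorphB /= -pmulrn.
(* For a zero eigenvalue the quotient is [0] by convention, and the bound reads [1 <= c]. *)
have [->|l0] := eqVneq (lambda A n) 0.
  by rewrite normr0 invr0 mulr0 subr_ge0 ler1n.
rewrite ler_pdivrMr ?normr_gt0 // mulrC; apply: (le_trans H).
by apply: ler_wpM2r; [rewrite subr_ge0 ler1n | rewrite -normrN ler_norm].
Qed.

(** Colours [0] and [1] are the sides of a bipartite union of components, [2] is the rest of the
    graph. *)
Definition bipartite_type : rel 'I_3 := fun i j =>
  if i == 0 then j == 1 else if i == 1 then j == 0 else j == 2.

(* An eigenvector for [-d] has constant modulus, and alternating signs, on the
   component where its modulus is maximal. *)
Lemma bipartite_component : (0 < n)%N -> (0 < d)%N ->
  ~~ (3 <= hoffman_bound R d E) ->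
  exists sig : {ffun 'I_n -> 'I_3},
    (exists u, sig u != 2) /\ forall u v, adj E u v -> bipartite_type (sig u) (sig v).
Proof.
move=> n0 d0; rewrite -ltNge /hoffman_bound => H.
have [c Hc] := colorable_ex E.
have [c0 Hd] := hoffman_inequality n0 Hc.
have dp : 0 < d%:R :> R by rewrite ltr0n.
have ln : lambda A n < 0.
  rewrite ltNge; apply/negP => l0; have := lt_le_trans dp Hd.
  rewrite ltNge mulNr oppr_le0 mulr_ge0 //; by rewrite subr_ge0 ler1n.
have ld : lambda A n <= - d%:R.
  have : Num.ceil (d%:R / `|lambda A n|) <= 1 by move: H; lia.
  rewrite ceil_le_int ltr0_norm // ler_pdivrMr ?oppr_gt0 //; lra.
set l := lambda A n in ln ld.
have [v vA v0] : exists2 v : 'rV[R]_n, v *m A = l *: v & v != 0.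
  apply: eigenvalues_vector adjacency_sym _ _.
  by apply: mem_lambda adjacency_sym _ _; rewrite n0 /=.
have [i _ Hi] := @arg_maxP _ _ _ (Ordinal n0) xpredT (fun i => `|v 0 i|) isT.
set M := `|v 0 i| in Hi.
have M0 : 0 < M.
  rewrite normr_gt0; apply: contraNneq v0 => vi; apply/eqP/rowP=> j.
  rewrite mxE; apply/eqP; rewrite -normr_le0; apply: le_trans (Hi j isT) _.
  by rewrite /M vi normr0.
(* Maximum principle: the terms [(y z + M) * A z u] are nonnegative and add up to [(l + d) M <= 0],
   so all vanish. A general [y] serves both the eigenvector and its negative. *)
have key (y : 'I_n -> R) : (forall j, `|y j| <= M) ->
    (forall u, \sum_w y w * A w u = l * y u) ->
    forall u w, y u = M -> adj E u w -> y w = - M.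
  move=> yM yA u w yu auw.
  have ge0 z : 0 <= (y z + M) * A z u.
    rewrite mulr_ge0 //; last by rewrite mxE.
    by have := yM z; rewrite ler_norml => /andP[]; lra.
  have S : \sum_z (y z + M) * A z u <= 0.
    under eq_bigr => z _ do rewrite mulrDl.
    rewrite big_split /= yA yu -mulr_sumr.
    under eq_bigr => z _ do rewrite -adjacency_sym mxE.
    by rewrite adjacency_row [M * _]mulrC -mulrDl; apply: mulr_le0_ge0 (ltW M0); lra.
  have : (y w + M) * A w u <= 0.
    apply: le_trans S; rewrite (bigD1 w) //= lerDl; exact: sumr_ge0.
  rewrite mxE adj_sym auw mulr1 => h.
  by have := yM w; rewrite ler_norml => /andP[]; lra.
have vE u : \sum_w v 0 w * A w u = l * v 0 u.
  by have := congr1 (fun r : 'rV_n => r 0 u) vA; rewrite !mxE.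
have k1 := key (fun j => v 0 j) (fun j => Hi j isT) vE.
have k2 : forall u w, v 0 u = - M -> adj E u w -> v 0 w = M.
  move=> u w vu auw; apply/eqP; rewrite -eqr_opp; apply/eqP.
  apply: (key (fun j => - v 0 j) _ _ u w) => //; rewrite ?vu ?opprK //.
    by move=> j; rewrite normrN; apply: Hi.
  move=> z; rewrite mulrN -vE -sumrN; apply: eq_bigr => j _; ring.
have MM : (M == - M) = false by apply/negP => /eqP; lra.
have MM' : (- M == M) = false by rewrite eq_sym.
exists [ffun u => if v 0 u == M then 0 else if v 0 u == - M then 1 else 2].
split.
  exists i; rewrite ffunE; case: (v 0 i =P M) => [//|]; case: (v 0 i =P - M) => [//|].
  by rewrite /M; case: (lerP 0 (v 0 i)) => h; rewrite ?(ger0_norm h) ?(ltr0_norm h) ?opprK //.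
move=> u w auw; rewrite !ffunE.
have [eu|nu] := eqVneq (v 0 u) M.
  by rewrite (k1 _ _ eu auw) MM' eqxx.
have [eu'|nu'] := eqVneq (v 0 u) (- M).
  by rewrite (k2 _ _ eu' auw) eqxx.
rewrite adj_sym in auw.
have [ew|nw] := eqVneq (v 0 w) M; first by rewrite (k1 _ _ ew auw) eqxx in nu'.
have [ew'|//] := eqVneq (v 0 w) (- M); by rewrite (k2 _ _ ew' auw) eqxx in nu.
Qed.

End Hoffman.

(** * Bipartite components *)

Section BipartiteComponents.
Variable R : realType.
Local Notation e := (expR 1 : R).

(* With the weights [sqrt s, sqrt s, sqrt t] on the three classes, the total
   weight of the allowed pairs of colours is [2 s + t = n]. *)
Lemma bipartite_words_le (Q : finType) (n d s : nat) (sig : 'I_n -> 'I_3) :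
  (0 < d)%N -> (0 < s)%N -> (#|Q| * 2 = n * d)%N ->
  class_size sig 0 = s -> class_size sig 1 = s ->
  #|[set w in balanced Q n d |
      good_colors bipartite_type (colors sig w)]%SET|%:R * n%:R ^+ (d * s) <=
  #|balanced Q n d|%:R * (e * (n * d).+1%:R) ^+ 3 * s%:R ^+ (d * s).
Proof.
move=> d0 s0 cQ c0 c1; pose t := class_size sig 2.
have o0 : ord0 = 0 :> 'I_3 by apply: val_inj.
have o1 : lift ord0 ord0 = 1 :> 'I_3 by apply: val_inj.
have o2 : lift ord0 (lift ord0 ord0) = 2 :> 'I_3 by apply: val_inj.
have nE : n = (s + s + t)%N.
  rewrite -[LHS](sum_class_size sig) !big_ord_recl big_ord0 o1 o2 addn0 addnA.
  by rewrite o0 c0 c1.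
have n0 : (0 < n)%N by lia.
pose x (j : 'I_3) : R := Num.sqrt (class_size sig j)%:R.
have := @card_good_words_entropy R Q n d _ sig bipartite_type x d0
  (fun j => sqrtr_ge0 _) cQ.
have P3 (F : 'I_3 -> R) : \prod_j F j = F 0 * F 1 * F 2.
  rewrite !big_ord_recl big_ord0 mulr1 mulrA.
  by rewrite o1 o2 o0.
have S3 (F : 'I_3 -> R) : \sum_j F j = F 0 + F 1 + F 2.
  rewrite !big_ord_recl big_ord0 addr0 addrA.
  by rewrite o1 o2 o0.
have xx j : x j ^+ 2 = (class_size sig j)%:R by rewrite sqr_sqrtr.
have -> : \sum_i \sum_(j | bipartite_type i j) x i * x j = n%:R.
  rewrite S3; under eq_bigl => j do rewrite /bipartite_type /=.
  rewrite !big_pred1_eq.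
  rewrite {1}nE !natrD -{1}c0 -c1 -!xx /x c0 c1 -/t; ring.
rewrite card_ord !P3 c0 c1 -/t.
have x0E : x 0 = Num.sqrt s%:R by rewrite /x c0.
have x1E : x 1 = Num.sqrt s%:R by rewrite /x c1.
have x2E : x 2 = Num.sqrt t%:R by [].
have sE : Num.sqrt s%:R ^+ (d * s) * Num.sqrt s%:R ^+ (d * s) = s%:R ^+ (d * s) :> R.
  by rewrite -exprMn -expr2 sqr_sqrtr.
have tE : t%:R ^+ (d * t) = Num.sqrt t%:R ^+ (d * t) * Num.sqrt t%:R ^+ (d * t) :> R.
  by rewrite -exprMn -expr2 sqr_sqrtr.
(* [#|Q| = d s + d t / 2], and the square root of [n] carries the half-integral exponent. *)
have qE : n%:R ^+ #|Q| = n%:R ^+ (d * s) * Num.sqrt n%:R ^+ (d * t) :> R.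
  rewrite -{1 2}(sqr_sqrtr (ler0n R n)) -!exprM -exprD; congr (_ ^+ _); nia.
have nqE : n%:R ^+ (n * d) = n%:R ^+ #|Q| * n%:R ^+ #|Q| :> R.
  by rewrite -exprD; congr (_ ^+ _); lia.
rewrite x0E x1E x2E sE tE nqE qE.
(* The remaining class contributes [(t/n)^(d t/2)], which is bounded by 1. *)
have TN : Num.sqrt t%:R ^+ (d * t) <= Num.sqrt n%:R ^+ (d * t) :> R.
  by apply: lerXn2r; rewrite ?nnegrE ?sqrtr_ge0 // ler_sqrt // ler_nat; lia.
have T0 : 0 < Num.sqrt t%:R ^+ (d * t) :> R.
  case: (posnP t) => [->|h]; first by rewrite muln0 expr0.
  by rewrite exprn_gt0 // sqrtr_gt0 ltr0n.
have S0 : 0 < s%:R ^+ (d * s) :> R by rewrite exprn_gt0 // ltr0n.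
have a0 : 0 < n%:R ^+ (d * s) :> R by rewrite exprn_gt0 // ltr0n.
have E0 : 0 <= #|balanced Q n d|%:R * (e * (n * d).+1%:R) ^+ 3.
  by rewrite mulr_ge0 // exprn_ge0 // mulr_ge0 // expR_ge0.
move: (_ * _ ^+ 3 : R) E0 => K E0; move: (_%:R : R) => G.
move: (Num.sqrt t%:R ^+ _) (Num.sqrt n%:R ^+ _) TN T0 => T N TN T0.
move: (s%:R ^+ _) (n%:R ^+ _) S0 a0 => S a S0 a0 H.
have N0 := lt_le_trans T0 TN.
have P0 : 0 < a * N * S * T by rewrite !mulr_gt0.
rewrite -(ler_pM2l N0); apply: (@le_trans _ _ (K * S * T)); last first.
  by rewrite mulrC; apply: ler_wpM2r TN; rewrite mulr_ge0 // ltW.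
by rewrite -(ler_pM2l P0); move: H; lra.
Qed.

Lemma expR1_le3 : e <= 3.
Proof.
(* [6] is the least [k] with [(1 - 1/k)^(-k) <= 3]. *)
have -> : e = ((expR (- (6%:R^-1))) ^+ 6)^-1.
  by rewrite -expRM_natl (_ : _ * _ = -1) ?expRN ?invrK //; lra.
have h : 5 / 6 <= expR (- 6^-1) :> R by apply: le_trans (expR_ge1Dx _); lra.
have h6 : (5 / 6) ^+ 6 <= expR (- 6^-1) ^+ 6 :> R.
  by apply: lerXn2r; rewrite ?nnegrE ?expR_ge0 //; lra.
rewrite -[leRHS]invrK lef_pV2 ?posrE ?invr_gt0 //; last by rewrite exprn_gt0 // expR_gt0.
by apply: le_trans h6; lra.
Qed.

(** [flip] exchanges the half-edges coloured [0] and [1], and each class carries [d] half-edges per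
    vertex. *)
Lemma class_sizes_swap (Q : finType) (n d : nat) (sig : 'I_n -> 'I_3) w :
  (0 < d)%N -> w \in balanced Q n d -> good_colors bipartite_type (colors sig w) ->
  class_size sig 0 = class_size sig 1.
Proof.
move=> d0 wB /forallP gw; apply/eqP; rewrite -(eqn_pmul2l d0).
rewrite -!(card_color_class _ _ wB) -(card_imset _ (@flip_inj Q)); apply/eqP.
have g p : bipartite_type (sig (w p)) (sig (w (flip p))).
  case: p => q []; have := gw q; rewrite !ffunE /flip //=.
  by rewrite /bipartite_type; do 2!case: (sig _) => [[|[|[|]]]].
apply: eq_card => p; apply/imsetP/idP => [[p']|]; rewrite !inE.
  by move=> h ->; have := g p'; rewrite (eqP h).
move=> h; exists (flip p); rewrite ?flipK // inE.
by have := g p; rewrite (eqP h).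
Qed.

Lemma card_two_classes (n s : nat) :
  (#|[set f : {ffun 'I_n -> 'I_3} | (class_size f 0%R == s) && (class_size f 1%R == s)]%SET|
   <= 'C(n, s) ^ 2)%N.
Proof.
pose h (f : {ffun 'I_n -> 'I_3}) := ([set v | f v == 0]%SET, [set v | f v == 1]%SET).
have hi : injective h.
  move=> f g [/setP H0 /setP H1]; apply/ffunP=> v.
  have := H0 v; have := H1 v; rewrite !inE; do 2!case: (_ v) => [[|[|[|]]] ?] //=;
  by move=> _ _; apply: val_inj.
rewrite -(card_imset _ hi).
pose D := [set A : {set 'I_n} | #|A| == s]%SET.
have -> : ('C(n, s) ^ 2 = #|setX D D|)%N by rewrite cardsX card_draws card_ord.
apply: subset_leq_card; apply/subsetP=> _ /imsetP[f + ->].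
by rewrite !inE.
Qed.

Lemma ffact_le_expn (n s : nat) : (n ^_ s <= n ^ s)%N.
Proof.
elim: s => [|s IH]; first by rewrite ffactn0.
by rewrite ffactnSr expnSr leq_mul // leq_subr.
Qed.

(** Let [y = s / n]. Two of the seven factors [y ^ s] tame the binomials, as
    ['C(n, s) * y ^ s <= e ^ s <= 3 ^ s]. Of the other five, [y ^ 5] is kept for the decay in [n]
    and the rest is at most [(1 / 32) ^ (s - 1)] because [y <= 1/2]. The ratio [9 / 32] leaves room
    for [s ^ 5]. *)
Lemma union_term_le (n s : nat) : (0 < s)%N -> (s * 2 <= n)%N ->
  ('C(n, s) ^ 2)%:R * (s%:R / n%:R) ^+ (7 * s) <= 2 ^+ 15 / n%:R ^+ 5 :> R.
Proof.
move=> s0 sn; have e7 : (7 * s = s * 2 + 5 * s)%N by lia.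
have n0 : 0 < n%:R :> R by rewrite ltr0n; lia.
have sp : 0 < s%:R :> R by rewrite ltr0n.
set y := s%:R / n%:R; have y0 : 0 < y by rewrite divr_gt0.
have yge0 := ltW y0; have y2 : y <= 1 / 2.
  by rewrite ler_pdivrMr // mulrC mulrA mulr1 ler_pdivlMr // -natrM ler_nat.
have C1 : ('C(n, s))%:R * y ^+ s <= 3 ^+ s.
  have c1 : ('C(n, s))%:R * (s`!)%:R <= n%:R ^+ s :> R.
    by rewrite -natrM bin_ffact -natrX ler_nat ffact_le_expn.
  have f1 : s%:R ^+ s <= (s`!)%:R * 3 ^+ s :> R.
    apply: le_trans (fact_lower R s) _; apply: ler_wpM2l => //.
    by apply: lerXn2r; rewrite ?nnegrE ?expR_ge0 // expR1_le3.
  rewrite expr_div_n mulrA ler_pdivrMr ?exprn_gt0 //.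
  have h1 := ler_wpM2l (ler0n R 'C(n, s)) f1.
  have h2 := ler_wpM2r (exprn_ge0 s (ler0n R 3)) c1.
  by apply: (le_trans h1); rewrite mulrA [leRHS]mulrC.
have C2 : (('C(n, s))%:R * y ^+ s) ^+ 2 <= (9 : R) ^+ s.
  have -> : (9 : R) ^+ s = (3 ^+ s) ^+ 2 by rewrite -exprM mulnC exprM; congr (_ ^+ _); ring.
  by apply: lerXn2r C1; rewrite nnegrE ?exprn_ge0 // mulr_ge0 // exprn_ge0 // ltW.
have Y1 : y ^+ (5 * s) <= y ^+ 5 * 32 * (1 / 32) ^+ s.
  move: (y) yge0 y2 => z z0 z2; case: (s) s0 => // k _.
  rewrite mulnS exprD -mulrA; apply: ler_wpM2l; first exact: exprn_ge0.
  rewrite exprS mulrA (_ : 32 * (1 / 32) = 1 :> R) ?mul1r; last by lra.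
  rewrite exprM; apply: lerXn2r; rewrite ?nnegrE ?exprn_ge0 //; first by lra.
  have : z ^+ 5 <= (1 / 2) ^+ 5 by apply: lerXn2r; rewrite ?nnegrE //; lra.
  by lra.
have S1 : s%:R <= 4 * (5 / 4) ^+ s :> R.
  elim: (s) => [|k IH]; first by rewrite expr0; lra.
  by rewrite exprS -natr1; have : 1 <= (5 / 4) ^+ k :> R; [apply: exprn_ege1; lra | lra].
have S5 : s%:R ^+ 5 <= 1024 * (3125 / 1024) ^+ s :> R.
  have -> : 1024 * (3125 / 1024) ^+ s = (4 * (5 / 4) ^+ s) ^+ 5 :> R.
    by rewrite [RHS]exprMn -[in RHS]exprM mulnC [in RHS]exprM; congr (_ * _ ^+ _); lra.
  by apply: lerXn2r; rewrite ?nnegrE ?mulr_ge0 ?exprn_ge0 //; lra.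
have -> : ('C(n, s) ^ 2)%:R * y ^+ (7 * s) = ('C(n, s)%:R * y ^+ s) ^+ 2 * y ^+ (5 * s).
  have -> : y ^+ (7 * s) = (y ^+ s) ^+ 2 * y ^+ (5 * s).
    by rewrite e7 exprD exprM.
  by rewrite natrX; move: (y ^+ s) (y ^+ _) => a b; ring.
apply: (@le_trans _ _ (9 ^+ s * (y ^+ 5 * 32 * (1 / 32) ^+ s))).
  by apply: ler_pM C2 Y1; rewrite exprn_ge0 // mulr_ge0 // exprn_ge0.
have -> : (9 : R) ^+ s * (y ^+ 5 * 32 * (1 / 32) ^+ s) =
    32 * (s%:R ^+ 5 * (9 / 32) ^+ s) / n%:R ^+ 5.
  have -> : (9 / 32) ^+ s = 9 ^+ s * (1 / 32) ^+ s :> R.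
    by rewrite -exprMn; congr (_ ^+ _); lra.
  rewrite [y ^+ 5]expr_div_n; move: (9 ^+ s) ((1 / 32) ^+ s) (s%:R ^+ 5) => a b c.
  by move: (n%:R ^+ 5)^-1 => z; ring.
apply: ler_wpM2r; first by rewrite invr_ge0 exprn_ge0.
have : s%:R ^+ 5 * (9 / 32) ^+ s <= 1024 * ((3125 / 1024) * (9 / 32)) ^+ s :> R.
  have gen (a b : R) : 0 <= a -> s%:R ^+ 5 <= 1024 * b ^+ s ->
      s%:R ^+ 5 * a ^+ s <= 1024 * (b * a) ^+ s.
    by move=> a0 h; rewrite exprMn mulrA; apply: ler_wpM2r h; apply: exprn_ge0.
  by apply: gen S5; lra.
have : ((3125 / 1024) * (9 / 32)) ^+ s <= 1 :> R by apply: exprn_ile1; lra.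
by lra.
Qed.

End BipartiteComponents.

(** * Union bound over the bipartite components *)

Section HoffmanWhp.
Variable R : realType.

Lemma bad_hoffman_color (Q : finType) n d (w : {ffun Q * bool -> 'I_n}) :
  (0 < n)%N -> (0 < d)%N -> w \in balanced Q n d -> simple w ->
  ~~ (3 <= hoffman_bound R d (word_graph w)) ->
  exists f : {ffun 'I_n -> 'I_3},
    [/\ good_colors bipartite_type (colors f w), (0 < class_size f 0%R)%N,
        class_size f 1%R = class_size f 0%R & (class_size f 0%R * 2 <= n)%N].
Proof.
move=> n0 d0 wB sw H.
have rw : is_regular d (word_graph w) by rewrite simple_balanced_regular.
have [f [[u fu] Hf]] := bipartite_component rw n0 d0 H.
have gw : good_colors bipartite_type (colors f w).
  apply/forallP=> q; rewrite !ffunE; apply: Hf.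
  by rewrite /adj (simple_loopless (q, false) sw) /=; apply: imset_f.
have e := class_sizes_swap d0 wB gw; exists f; split=> //.
  have : (0 < class_size f 0%R)%N || (0 < class_size f 1%R)%N.
    apply/orP; move: fu; case fu : (f u) => [[|[|[|]]] hk] //= _; [left|right];
    by apply/card_gt0P; exists u; rewrite inE fu; apply/eqP/val_inj.
  by rewrite -e orbb.
have := sum_class_size f; rewrite (bigD1 0) //= (bigD1 1) //= -e addnA addnn -muln2.
by move=> S; apply: leq_trans (leq_addr _ _) (eq_leq S).
Qed.

Lemma whp_hoffman : whp R 7 (fun n E => 3 <= hoffman_bound R 7 E).
Proof.
(* [8] comes from [7 n + 1 <= 8 n]. The [2 ^ 15] of [union_term_le] is doubled for the at most [2 n]
   values of [s], and again for [1 / n <= 2 / (n + 1)], since [harmonic n] is [1 / (n + 1)]. *)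
pose C : R := (expR 1 * 8) ^+ 3 * 2 ^+ 17.
apply: (@whp_of_words R 7 _ (fun n => C * harmonic n) 1) => //.
  by have := cvgM (cvg_cst C) (@cvg_harmonic R); rewrite mulr0; exact.
move=> Q n n0 cQ; set BB := balanced Q n 7.
pose G (f : {ffun 'I_n -> 'I_3}) :=
  #|[set w in BB | good_colors bipartite_type (colors f w)]%SET|.
pose ok (s : nat) := (0 < s)%N && (s * 2 <= n)%N.
pose T (s : nat) (f : {ffun 'I_n -> 'I_3}) :=
  (class_size f 0%R == s) && (class_size f 1%R == s).
apply: (@le_trans _ _ (\sum_(s < n.+1 | ok s) \sum_(f | T s f) (G f)%:R)).
  under eq_bigr => s _ do rewrite -natr_sum.
  rewrite -natr_sum ler_nat pair_big_dep /=.
  under eq_bigr => f _ do rewrite /G -sum1dep_card.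
  rewrite -sum1dep_card (exchange_big_dep (mem BB)) /=; last by move=> f w _ /andP[].
  rewrite big_mkcond [X in (_ <= X)%N]big_mkcond; apply: leq_sum => w _.
  case wB : (w \in BB) => //=; case: ifP => // /andP[sw H].
  have [f [gf f0 f1 fn]] := bad_hoffman_color n0 (isT : 0 < 7)%N wB sw H.
  have lt : (class_size f 0%R < n.+1)%N by rewrite ltnS class_size_le.
  by rewrite (bigD1 (Ordinal lt, f)) //= /ok /T f0 fn f1 eqxx gf.
have b0 : 0 <= #|BB|%:R :> R by [].
have E0 : 0 <= #|BB|%:R * (expR 1 * (n * 7).+1%:R) ^+ 3 :> R.
  by rewrite mulr_ge0 // exprn_ge0 // mulr_ge0 // expR_ge0.
have nR : 0 < n%:R :> R by rewrite ltr0n.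
apply: (@le_trans _ _ (\sum_(s < n.+1 | ok s)
   #|BB|%:R * (expR 1 * (n * 7).+1%:R) ^+ 3 * (2 ^+ 15 / n%:R ^+ 5))).
  apply: ler_sum => s /andP[s0 sn].
  apply: le_trans (ler_wpM2l E0 (union_term_le R s0 sn)).
  apply: (@le_trans _ _ (\sum_(f | T s f)
      #|BB|%:R * (expR 1 * (n * 7).+1%:R) ^+ 3 * (s%:R / n%:R) ^+ (7 * s))).
    apply: ler_sum => f /andP[/eqP f0 /eqP f1].
    rewrite expr_div_n [leRHS]mulrA ler_pdivlMr ?exprn_gt0 //.
    have h := bipartite_words_le R (isT : 0 < 7)%N s0 cQ f0 f1.
    exact: h.
  rewrite sumr_const -[leLHS]mulr_natr -mulrA; apply: ler_wpM2l => //.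
  rewrite mulrC; apply: ler_wpM2r; first by rewrite exprn_ge0 // divr_ge0.
  rewrite ler_nat; apply: leq_trans (card_two_classes n s).
  by apply: subset_leq_card; apply/subsetP=> f; rewrite inE.
have -> : forall x : R, \sum_(s < n.+1 | ok s) x = x *+ #|[pred s : 'I_n.+1 | ok s]|.
  by move=> x; rewrite sumr_const.
apply: (@le_trans _ _ (#|BB|%:R * (expR 1 * (8 * n%:R)) ^+ 3 * (2 ^+ 15 / n%:R ^+ 5) * (2 * n%:R))).
  rewrite -[leLHS]mulr_natr; apply: ler_pM => //.
  - by rewrite mulr_ge0 // divr_ge0 // exprn_ge0.
  - apply: ler_wpM2r; first by rewrite divr_ge0 // exprn_ge0.
    apply: ler_wpM2l => //; apply: lerXn2r; rewrite ?nnegrE ?mulr_ge0 ?expR_ge0 //.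
    by apply: ler_wpM2l; rewrite ?expR_ge0 // -natrM ler_nat; lia.
  - rewrite -natrM ler_nat; apply: (@leq_trans n.+1); last by lia.
    by rewrite -[X in (_ <= X)%N]card_ord max_card.
have -> : #|BB|%:R * (expR 1 * (8 * n%:R)) ^+ 3 * (2 ^+ 15 / n%:R ^+ 5) * (2 * n%:R) =
   (expR 1 * 8) ^+ 3 * 2 ^+ 16 * n%:R^-1 * #|BB|%:R :> R.
  have nz : n%:R != 0 :> R by rewrite lt0r_neq0.
  by move: (expR 1) (#|BB|%:R) (n%:R) nz => a b c nz; field.
apply: ler_wpM2r => //; rewrite /C -mulrA -[leRHS]mulrA.
apply: ler_wpM2l; first by rewrite exprn_ge0 // mulr_ge0 // expR_ge0.
rewrite [2 ^+ 17]exprSr -mulrA; apply: ler_wpM2l; first exact: exprn_ge0.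
rewrite /harmonic /= ler_pdivlMr ?ltr0n // mulrC ler_pdivrMr //.
by rewrite -natrM ler_nat; lia.
Qed.

Lemma hoffman_certifies : certifies_whp R 7 chromatic_number (hoffman_bound R 7) 3.
Proof.
split; last exact: whp_hoffman.
move=> n E n0 rE; apply: (hoffman_bound_le R rE n0).
by rewrite /chromatic_number; case: ex_minnP.
Qed.

End HoffmanWhp.

(** * Thresholding the output of a Turing machine *)

Section Threshold.
Variables (T : machine) (K : nat).

(* After [T] halts, scan the output from its most significant bit, keeping the
   value read so far capped at [K]; then overwrite the blank that ends it. *)
Definition threshold_delta (s : state T + option 'I_K.+1) (a : option bool) :
    (state T + option 'I_K.+1) * option bool * direction :=
  match s, a with
  | inl q, _ =>
      if halting q then (inr (Some ord0), a, Stay)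
      else let: (q', b, dir) := delta q a in (inl q', b, dir)
  | inr (Some v), Some b => (inr (Some (inord (minn (v.*2 + b) K))), a, MoveRight)
  | inr (Some v), None => (inr None, Some (v < K)%N, Stay)
  | inr None, _ => (inr None, a, Stay)
  end.

Definition threshold_machine : machine :=
  Machine (inl (start T)) (fun s => s == inr None) threshold_delta.

Definition embed (C : config T) : config threshold_machine :=
  let: Config q l r := C in @Config threshold_machine (inl q) l r.

Lemma embed_step (C : config T) : ~~ halting (conf_state C) ->
  step (embed C) = embed (step C).
Proof.
case: C => q l r /= nh; rewrite (negPf nh) /=.
by case: (delta q _) => [[q' b] []].
Qed.

(** [T] idles once it halts while the new machine moves on, so the simulation must stop at the
    halting time [t0]. *)
Lemma embed_iter (C : config T) t : exists2 t0, (t0 <= t)%N &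
  iter t0 (@step threshold_machine) (embed C) = embed (iter t (@step T) C).
Proof.
elim: t => [|t [t0 h E]]; first by exists 0%N.
case hC : (halting (conf_state (iter t (@step T) C))).
  exists t0; first exact: leqW.
  by rewrite E iterS; move: hC; case: (iter t _ C) => q l r /= ->.
by exists t0.+1; rewrite // !iterS E embed_step // hC.
Qed.

Lemma scan_output (v : 'I_K.+1) l r : exists l' r',
  iter (size (leading_bits r)).+1 (@step threshold_machine)
    (@Config threshold_machine (inr (Some v)) l r) =
  @Config threshold_machine (inr None) l'
    (Some (foldl (fun (x : nat) (b : bool) => x.*2 + b)%N v (leading_bits r) < K)%N :: r').
Proof.
elim: r v l => [|[b|] r IH] v l; first by exists l, [::].
  rewrite [leading_bits _]/= [size _]/= iterSr.
  have -> : @step threshold_machine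
      (Config (inr (Some v) : state threshold_machine) l (Some b :: r)) =
    Config (inr (Some (inord (minn (v.*2 + b) K))) : state threshold_machine) (Some b :: l) r by [].
  have [l' [r' ->]] := IH (inord (minn (v.*2 + b) K)) (Some b :: l).
  exists l', r'; congr (Config _ _ (Some _ :: _)).
  rewrite inordK ?ltnS ?geq_minr //=.
  (* Capping before each further digit preserves the comparison with [K]: a value that has reached
     [K] never drops below it again. *)
  move: (v.*2 + b)%N => z; elim: (leading_bits r) z => [|b' s IHs] x /=.
    by rewrite !ltnNge leq_min leqnn andbT.
  rewrite -(IHs (x.*2 + b')%N) -(IHs ((minn x K).*2 + b')%N).
  congr (foldl _ _ _ < K)%N; lia.
by exists l, r.
Qed.

Lemma halted_iter (M : machine) (C : config M) t : halting (conf_state C) ->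
  iter t (@step M) C = C.
Proof.
move=> h; elim: t => [//|t IH]; rewrite iterS IH.
by move: h; case: C {IH} => q l r /= ->.
Qed.

(** Two cells per step: moving left from an empty right tape creates both the written cell and the
    newly scanned one. *)
Lemma size_right_iter (C : config T) t :
  (size (conf_right (iter t (@step T) C)) <= size (conf_right C) + t * 2)%N.
Proof.
elim: t => [|t IH]; first by rewrite addn0.
rewrite iterS mulSn addnCA; apply: leq_trans (_ : _ <= 2 + _)%N _; last first.
  by rewrite leq_add2l; exact: IH.
case: (iter t _ C) => q l r /=; case: (halting q) => /=; first by rewrite leq_addl.
by case: (delta q _) => [[q' b] []]; case: r => //= *; lia.
Qed.

Lemma size_leading_bits r : (size (leading_bits r) <= size r)%N.
Proof. by elim: r => [//|[b|] r IH]. Qed.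

(** The budget: at most [t] steps of simulation, one to start scanning, one for each of at most
    [size x + 2 t] digits, and one to write the answer. *)
Lemma threshold_outputs x y t u : outputs_within T x y t ->
  (t * 3 + size x + 2 <= u)%N ->
  let C := iter u (@step threshold_machine) (initial threshold_machine x) in
  halting (conf_state C) /\
  head false (leading_bits (conf_right C)) = (decode_nat y < K)%N.
Proof.
rewrite /outputs_within => -[hT yE] tu.
have [t0 t0t E] := embed_iter (initial T x) t.
have sr := size_right_iter (initial T x) t; rewrite /= size_map in sr.
case CE : (iter t (@step T) (initial T x)) hT yE sr E => [q l r] /= hq yE sr E.
(* The step that starts the scan rewrites the scanned cell, which makes an implicit blank
   explicit. *)
pose r1 := head None r :: behead r.
have lr : leading_bits r1 = leading_bits r by rewrite /r1; case: (r).
have [l' [r' S]] := scan_output ord0 l r1.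
have sl := size_leading_bits r; rewrite lr yE in S; rewrite yE in sl.
pose m := ((size y).+1 + (1 + t0))%N.
have mu : (m <= u)%N by rewrite /m; lia.
have Em : iter m (@step threshold_machine) (initial threshold_machine x) =
  @Config threshold_machine (inr None) l' (Some (decode_nat y < K)%N :: r').
  rewrite /m iterD -S; congr (iter _ _ _); rewrite iterD [iter t0 _ _]E.
  by rewrite /= hq.
by rewrite -(subnK mu) iterD Em halted_iter.
Qed.
End Threshold.

Lemma polytime_threshold (f : seq bool -> seq bool) (K : nat) : polytime f ->
  exists g, polytime g /\
    forall x, head false (g x) = (decode_nat (f x) < K)%N.
Proof.
move=> [T [c [e Tf]]].
(* The exponent [e.+1] leaves room for the linear term [size x] even if [e = 0]; the constant
   [6 * c] covers the empty input, where [0 ^ 0 = 1]. *)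
pose bound (x : seq bool) := ((6 * c + 3) * size x ^ e.+1 + (6 * c + 3))%N.
pose M := threshold_machine T K.
pose g x := leading_bits (conf_right (iter (bound x) (@step M) (initial M x))).
have H x : halting (conf_state (iter (bound x) (@step M) (initial M x))) /\
    head false (g x) = (decode_nat (f x) < K)%N.
  apply: (threshold_outputs _ (Tf x)); rewrite /bound.
  case: (posnP (size x)) => [->|h].
    rewrite [(0 ^ e.+1)%N]exp0n //; have : (0 ^ e <= 1)%N by case: (e) => // k; rewrite exp0n.
    by nia.
  have : (0 < size x ^ e)%N by rewrite expn_gt0 h.
  rewrite expnS; nia.
exists g; split=> [|x]; last by have [] := H x.
by exists M, (6 * c + 3)%N, e.+1 => x; split; [exact: (H x).1|].
Qed.

(** * A 3-colourable Ramanujan base graph *)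

Lemma chromatic_le n (E : graph n) c : colorable E c -> (chromatic_number E <= c)%N.
Proof. by rewrite /chromatic_number; case: ex_minnP => m _; apply. Qed.

Lemma respectful_lift_colorable k (M : 'M[nat]_k) (c : nat) (col : 'I_k -> 'I_c)
    m (w : lift_sample M m) (E : graph (k * m)) :
  (forall i j, M i j != 0%N -> col i != col j) -> w \in lift_samples M m ->
  respects w (on_edges M) (E :\: lift_graph w)%SET -> colorable E c.
Proof.
move=> colM; rewrite inE => /andP[/andP[/injectiveP w_inj _] _] /forallP resp.
have w_bij : bijective w.2.
  by apply: inj_card_bij => //; rewrite card_prod !card_ord.
case: w_bij => g wK gK.
apply/existsP; exists [ffun v => col (g v).1]; apply/forallP=> u; apply/forallP=> v.
apply/implyP=> /andP[_]; rewrite !ffunE -(gK u) -(gK v) !wK.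
move: (g u) (g v) => p q uvE.
case uvL : ([set w.2 p; w.2 q]%SET \in lift_graph w); last first.
  apply: colM; have /forallP/(_ q) := resp p.
  by rewrite inE uvL uvE /= implybF negbK.
move: uvL => /bigcupP[e _ /imsetP[x _ E2]].
have ce : col (msrc e) != col (mtgt e).
  by apply: colM; case: e {E2} => e [a ha] /=; rewrite -lt0n; apply: leq_ltn_trans ha.
by move/set2_eqP: E2 => [[/w_inj-> /w_inj->]|[/w_inj-> /w_inj->]] //=; rewrite eq_sym.
Qed.

(* Vertices [2 j] and [2 j + 1] form the [j]-th of three parts. Around the
   3-cycle of parts, the blocks are [[2, 2], [1, 2]]. *)
Definition base_table : seq (seq nat) :=
  [:: [:: 0; 0; 2; 2; 2; 1]; [:: 0; 0; 1; 2; 2; 2]; [:: 2; 1; 0; 0; 2; 2];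
      [:: 2; 2; 0; 0; 1; 2]; [:: 2; 2; 2; 1; 0; 0]; [:: 1; 2; 2; 2; 0; 0]]%N.

Definition base : 'M[nat]_6 := \matrix_(i, j) nth 0%N (nth [::] base_table i) j.

Lemma base_sym i j : base i j = base j i.
Proof.
rewrite !mxE; case: i => [[|[|[|[|[|[|]]]]]] ?] //;
by case: j => [[|[|[|[|[|[|]]]]]] ?].
Qed.

Lemma base_regular : regular_multigraph 7 base.
Proof.
split=> [|i]; first exact: base_sym.
rewrite !big_ord_recl big_ord0 !mxE.
by case: i => [[|[|[|[|[|[|]]]]]] ?].
Qed.

Lemma part_subproof (i : 'I_6) : (i./2 < 3)%N.
Proof. by case: i => i hi /=; lia. Qed.

Definition part (i : 'I_6) : 'I_3 := Ordinal (part_subproof i).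

Lemma base_tripartite i j : base i j != 0%N -> part i != part j.
Proof.
rewrite mxE -(inj_eq val_inj) /=; case: i => [[|[|[|[|[|[|]]]]]] ?] //;
by case: j => [[|[|[|[|[|[|]]]]]] ?].
Qed.

Section BaseSpectrum.
Variable R : realType.
Local Notation A := (multi_adjacency R base).

Lemma multi_adjacency_sym : A^T = A.
Proof. by apply/matrixP=> i j; rewrite [LHS]mxE [LHS]mxE [RHS]mxE base_sym. Qed.

Lemma base_trace : \tr (A *m A) = 78%:R.
Proof.
rewrite /mxtrace; under eq_bigr => i _ do rewrite mxE.
rewrite !big_ord_recl !big_ord0 !mxE /=; lra.
Qed.

(** The quartic is the minimal polynomial of [base]. Multiplying the eigenvector equations by powers
    of [x] up to the third makes each claim linear in the monomials. *)
Lemma base_annihilator (x a b c d e f : R) :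
  c * 2 + d * 2 + e * 2 + f = x * a -> c + d * 2 + e * 2 + f * 2 = x * b ->
  a * 2 + b + e * 2 + f * 2 = x * c -> a * 2 + b * 2 + e + f * 2 = x * d ->
  a * 2 + b * 2 + c * 2 + d = x * e -> a + b * 2 + c * 2 + d * 2 = x * f ->
  [/\ (x - 7) * (x - 1) * (x ^+ 2 + 4 * x + 1) * a = 0,
      (x - 7) * (x - 1) * (x ^+ 2 + 4 * x + 1) * b = 0,
      (x - 7) * (x - 1) * (x ^+ 2 + 4 * x + 1) * c = 0,
      (x - 7) * (x - 1) * (x ^+ 2 + 4 * x + 1) * d = 0 &
      (x - 7) * (x - 1) * (x ^+ 2 + 4 * x + 1) * e = 0 /\
      (x - 7) * (x - 1) * (x ^+ 2 + 4 * x + 1) * f = 0].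
Proof.
move=> e0 e1 e2 e3 e4 e5.
have mul y z : y = z -> x * y = x * z :> R by move=> ->.
have [f0 f1 f2] := And3 (mul _ _ e0) (mul _ _ e1) (mul _ _ e2).
have [f3 f4 f5] := And3 (mul _ _ e3) (mul _ _ e4) (mul _ _ e5).
have [g0 g1 g2] := And3 (mul _ _ f0) (mul _ _ f1) (mul _ _ f2).
have [g3 g4 g5] := And3 (mul _ _ f3) (mul _ _ f4) (mul _ _ f5).
have [h0 h1 h2] := And3 (mul _ _ g0) (mul _ _ g1) (mul _ _ g2).
have [h3 h4 h5] := And3 (mul _ _ g3) (mul _ _ g4) (mul _ _ g5).
by split; [lra | lra | lra | lra | split; lra].
Qed.

Lemma base_spectrum x : x \in eigenvalues A -> x = 7 \/ `|x| <= 4.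
Proof.
move=> /(eigenvalues_vector multi_adjacency_sym)[v vA v0].
have E j : \sum_i v 0 i * A i j = x * v 0 j.
  by have := congr1 (fun r : 'rV_6 => r 0 j) vA; rewrite !mxE.
have all_ord (P : pred 'I_6) : P ord0 -> P (lift ord0 ord0) ->
    P (lift ord0 (lift ord0 ord0)) -> P (lift ord0 (lift ord0 (lift ord0 ord0))) ->
    P (lift ord0 (lift ord0 (lift ord0 (lift ord0 ord0)))) ->
    P (lift ord0 (lift ord0 (lift ord0 (lift ord0 (lift ord0 ord0))))) ->
    [forall j, P j].
  move=> p0 p1 p2 p3 p4 p5; apply/forallP=> j.
  case: (unliftP ord0 j) => [{}j|] -> //; case: (unliftP ord0 j) => [{}j|] -> //.
  case: (unliftP ord0 j) => [{}j|] -> //; case: (unliftP ord0 j) => [{}j|] -> //.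
  by case: (unliftP ord0 j) => [{}j|] -> //; rewrite ord1.
have p0 : [forall j, (x - 7) * (x - 1) * (x ^+ 2 + 4 * x + 1) * v 0 j == 0].
  move: (E ord0) (E (lift ord0 ord0)) (E (lift ord0 (lift ord0 ord0)))
    (E (lift ord0 (lift ord0 (lift ord0 ord0))))
    (E (lift ord0 (lift ord0 (lift ord0 (lift ord0 ord0)))))
    (E (lift ord0 (lift ord0 (lift ord0 (lift ord0 (lift ord0 ord0)))))).
  rewrite !big_ord_recl !big_ord0 !mxE /=.
  set a := v 0 ord0; set b := v 0 (lift ord0 ord0); set c := v 0 _; set d := v 0 _.
  set e := v 0 _; set f := v 0 _ => e0 e1 e2 e3 e4 e5.
  have [||||||q0 q1 q2 q3 [q4 q5]] := @base_annihilator x a b c d e f.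
  1-6: by lra.
  by apply: all_ord; apply/eqP.
have [j vj] : exists j, v 0 j != 0.
  apply/existsP; apply: contraNT v0; rewrite negb_exists => /forallP H.
  by apply/eqP/rowP=> j; rewrite mxE; apply/eqP; rewrite -[_ == _]negbK H.
have /forallP/(_ j) := p0; rewrite !mulf_eq0 (negPf vj) orbF -orbA.
case/or3P => [| |/eqP h]; rewrite ?subr_eq0.
- by move=> /eqP->; left.
- by move=> /eqP->; right; rewrite normr1; lra.
(* The quadratic says [x (x + 4) = -1], so [x] lies between [-4] and [0]. *)
right; move: h; clear => h; have x0 : x <= 0 by have := sqr_ge0 x; lra.
rewrite ler0_norm // lerNl leNgt; apply/negP => x4.
have : 0 <= (- x) * (- 4 - x) by rewrite mulr_ge0; lra.
by lra.
Qed.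

(** [base_spectrum] leaves multiplicities open. A second eigenvalue of at least [7] would give
    squares adding up to at least [98], beyond the trace [78]. *)
Lemma base_lambda2 : lambda A 2%N < 7.
Proof.
have [tr _] := eigenvalues_spec multi_adjacency_sym.
have sz := size_eigenvalues multi_adjacency_sym.
have l12 : lambda A 2%N <= lambda A 1%N by apply: (lambda_anti multi_adjacency_sym).
rewrite ltNge; apply/negP => l7; move: l7 l12 tr sz; rewrite base_trace /lambda /=.
case: (eigenvalues A) => [|x [|y s]] //= y7 xy; rewrite !big_cons => tr _.
have : 0 <= \sum_(z <- s) z ^+ 2 by apply: sumr_ge0 => z _; apply: sqr_ge0.
by move: tr; set t := \sum_(z <- s) _; nra.
Qed.

Lemma base_ramanujan : ramanujan R 7 base.
Proof.
have small i : (1 < i <= 6)%N -> `|lambda A i| <= 2 * Num.sqrt (7%:R - 1).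
  move=> /andP[i1 i6]; have l7 : lambda A i < 7.
    by apply: le_lt_trans base_lambda2; apply: (lambda_anti multi_adjacency_sym).
  have /base_spectrum : lambda A i \in eigenvalues A.
    by apply: (mem_lambda multi_adjacency_sym); rewrite i6 (ltn_trans _ i1).
  case=> [e|h]; first by rewrite e ltxx in l7.
  apply: (le_trans h); have : 2 <= Num.sqrt (7%:R - 1) :> R; last by lra.
  have -> : 2 = Num.sqrt (2 ^+ 2) :> R by rewrite sqrtr_sqr ger0_norm.
  by rewrite ler_sqrt; lra.
by rewrite /ramanujan ge_max !small.
Qed.

End BaseSpectrum.

(** * From certification to detection *)

Lemma prob_ge0 (R : realType) (T : finType) (S : {set T}) (P : pred T) :
  0 <= prob (uniform R S) P.
Proof. by rewrite prob_uniform divr_ge0. Qed.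

(** Validity of a respectful adversary speaks about every single output: it is [7]-regular, so the
    certificate is sound on it, and it inherits the 3-colouring. Answering that the input is a lift
    when the certified value is below [4] therefore never errs on nonempty lifts. *)
Lemma certification_fails (R : realType) : ConjectureL R ->
  ~ exists f, polytime f /\
      certifies_whp R 7 chromatic_number (numeric_output f) 4.
Proof.
move=> CL [f [pf [cert /tendsP whp4]]].
have eps : 0 < (2^-1 : R) < 1.
  by rewrite invr_gt0 ltr0n invf_lt1 ?ltr0n // ltr1n.
have [hR _] := CL 7%N 6%N base 2^-1 isT isT base_regular eps.
have [_ _ _ [S [valid hard]]] := hR (base_ramanujan R).
apply: hard; have [g [pg gE]] := polytime_threshold 4 pf.
have says n (E : graph n) : says_P g E = (decode_nat (f (encode E)) < 4)%N.
  exact: gE.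
exists g; split=> //; split.
  apply/tendsP => e e0; exists 1%N => m m0 _.
  suff -> : prob (noisy_lift (S m)) (fun E => ~~ says_P g E) = 0.
    by rewrite subrr normr0 ltW.
  rewrite /prob big1 // => E sE; rewrite ffunE big1 // => w _; rewrite ffunE.
  case: ifP => [wL|_]; last by rewrite mul0r.
  have [->|SE] := eqVneq (S m w E) 0; first by rewrite mulr0.
  have [_ /(_ E SE)[rE _ resp]] := valid m w wL.
  have c3 := respectful_lift_colorable base_tripartite wL resp.
  have := cert (6 * m)%N E; rewrite muln_gt0 m0 => /(_ isT rE).
  rewrite lez_nat => /leq_trans /(_ (chromatic_le c3)).
  by move: sE; rewrite says -leqNgt => h1 h2; have := leq_trans h1 h2.
apply/tendsP => e e0; have [N HN] := whp4 e e0; exists N => m mN _.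
have := HN (6 * m)%N; rewrite /regular_size oddM oddM /= => /(_ _ isT).
have mN6 : (N <= 6 * m)%N := leq_trans mN (@leq_pmull m 6 isT).
move=> /(_ mN6) H; rewrite sub0r normrN ger0_norm ?prob_ge0 //.
(* Without regular graphs the uniform law is identically [0], and so is the error. *)
rewrite /random_regular; have [->|S0] := set_0Vmem (regular_graphs (6 * m) 7).
  by rewrite prob_uniform cards0 invr0 mulr0 ltW.
have {}S0 : (0 < #|regular_graphs (6 * m) 7|)%N by have [E ES] := S0; apply/card_gt0P; exists E.
move: H; rewrite prob_uniform_compl // ger0_norm ?prob_ge0 //.
congr (_ <= _); apply: eq_bigl => E; rewrite says /numeric_output.
by rewrite lez_nat -ltnNge.
Qed.

Local Close Scope ring_scope.

Theorem theorem1p13 (R : realType) :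
  [/\ whp R 7 (fun n E => 4 <= chromatic_number E),
      certifies_whp R 7 chromatic_number (hoffman_bound R 7) 3 &
      ConjectureL R ->
        ~ exists f, polytime f /\
            certifies_whp R 7 chromatic_number (numeric_output f) 4].
Proof.
split; [exact: whp_chromatic | exact: hoffman_certifies |].
exact: certification_fails.
Qed.
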